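(* Let $n\ge2$ be an integer, let $0<C<D$, and let $E=\bigcup_{j=1}^n e^{i2\pi j/n}[C,D]$. Then the Faber--Walsh polynomials $b_{nk}$ for $E$ and the sequence $$(\alpha_j)_{j=1}^\infty=\left(e^{i2\pi(j-1)/n}\left(\frac{D^{n/2}+C^{n/2}}{2}\right)^{2/n}\right)_{j=1}^\infty$$ are the Chebyshev polynomials for $E$, i.e., $$b_{nk}(z)=T_{nk}(z;E),\quad k\ge0.$$
   Context: $\widehat{\mathbb{C}}=\mathbb{C}\cup\{\infty\}$. For a compact set $E$ and $j\ge0$, the $j$th Chebyshev polynomial for $E$ is the (here uniquely determined) polynomial $T_j(z;E)=\operatorname{argmin}\{\|p\|_E:p\text{ monic},\ \deg(p)=j\}$, where $\|\cdot\|_E$ is the maximum norm on $E$. Lemniscatic domain: for $N\ge1$, pairwise distinct $a_1,\ldots,a_N\in\mathbb{C}$ (the foci), real $m_1,\ldots,m_N>0$ with $\sum_j m_j=1$, and $\mu>0$, the set $\mathcal{L}=\{w\in\widehat{\mathbb{C}}:|U(w)|>\mu\}$ with $U(w)=\prod_{j=1}^N(w-a_j)^{m_j}$. Lemniscatic map (theorem of Walsh): let $E=\bigcup_{j=1}^N E_j$ with $E_1,\ldots,E_N\subseteq\mathbb{C}$ pairwise disjoint simply connected compact sets (connected, with connected complement), none a single point, and let $\mathcal{K}=\widehat{\mathbb{C}}\setminus E$. There exist a unique lemniscatic domain $\mathcal{L}=\{w\in\widehat{\mathbb{C}}:|U(w)|>\mu\}$, $U(w)=\prod_{j=1}^N(w-a_j)^{m_j}$,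 with $\mu$ equal to the logarithmic capacity of $E$, and a unique bijective conformal map $\Phi:\mathcal{K}\to\mathcal{L}$ with $\Phi(z)=z+\mathcal{O}(1/z)$ near infinity, called the lemniscatic map of $E$. Admissible sequences: a sequence $(\alpha_j)_{j\ge1}$ chosen from the foci $a_1,\ldots,a_N$ such that there is a constant $A>0$ with $|N_{k,j}-km_j|\le A$ for all $k\ge1$ and $1\le j\le N$, where $N_{k,j}$ is the number of times $a_j$ appears among $\alpha_1,\ldots,\alpha_k$. Put $u_k(w)=\prod_{j=1}^k(w-\alpha_j)$, $u_0=1$. Faber--Walsh polynomials: with $g_{\mathcal{K}}(z)=\log|U(\Phi(z))|-\log\mu$ (the Green's function of $\mathcal{K}$ with pole at infinity) and $\Gamma_\lambda=\{z\in\mathcal{K}:g_{\mathcal{K}}(z)=\log\lambda\}$ for $\lambda>1$, the $k$th Faber--Walsh polynomial for $E$ and $(\alpha_j)$ is $$b_k(z)=\frac{1}{2\pi i}\int_{\Gamma_\lambda}\frac{u_k(\Phi(\zeta))}{\zeta-z}\,d\zeta,$$ for any $\lambda>1$ such that $z$ lies in the interior of the positively oriented $\Gamma_\lambda$; it is a monic polynomial of degree $k$ (independent of $\lambda$). *)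

(* Defs.v *)
From HB Require Import structures.
From mathcomp Require Import all_boot all_order all_algebra all_fingroup.
From mathcomp Require Import complex.
From mathcomp Require Import all_classical all_reals all_analysis.

Set Implicit Arguments.
Unset Strict Implicit.
Unset Printing Implicit Defensive.

Import Order.TTheory GRing.Theory Num.Theory.
Import numFieldNormedType.Exports.

Local Open Scope classical_set_scope.
Local Open Scope ring_scope.
Local Open Scope complex_scope.

(* The modulus as a real number; [`|z|] itself has type [R[i]]. *)
Definition modc (R : realType) (z : R[i]) : R := complex.Re `|z|.

Definition expi (R : realType) (t : R) : R[i] := cos t +i* sin t.

(* For compact E the supremum is the maximum norm of p on E. *)
Definition pnorm (R : realType) (E : set R[i]) (p : {poly R[i]}) : R :=
  sup [set modc p.[z] | z in E].

(* T is the unique minimizer; [size p = j.+1] means deg p = j. *)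
Definition is_chebyshev (R : realType) (E : set R[i]) (j : nat)
    (T : {poly R[i]}) : Prop :=
  [/\ T \is monic, size T = j.+1 &
      forall p : {poly R[i]}, p \is monic -> size p = j.+1 -> p != T ->
        pnorm E T < pnorm E p].

Definition fekete (R : realType) (E : set R[i]) (k : nat) : R :=
  sup [set \prod_(i < k) \prod_(j < k | (i < j)%N) modc (z i - z j)
      | z in [set z : 'I_k -> R[i] | forall i, E (z i)]].

(* Logarithmic capacity as the transfinite diameter (Fekete): the limit of
   max prod_(i < j) |z_i - z_j|^(2 / (k (k - 1))) over k points of E. *)
Definition capacity (R : realType) (E : set R[i]) : R :=
  lim ((fun k : nat => fekete E k `^ (2 / (k * k.-1)%:R)) @ \oo).

Record lemniscatic (R : realType) (N : nat) := Lemniscatic {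
  foci : 'I_N -> R[i];
  expo : 'I_N -> R;
  mu : R;
  foci_inj : injective foci;
  expo_gt0 : forall j, 0 < expo j;
  expo_sum : \sum_j expo j = 1;
  mu_gt0 : 0 < mu }.

(* |U(w)|; U itself is multivalued and only its modulus is ever used. *)
Definition absU (R : realType) (N : nat) (L : lemniscatic R N) (w : R[i]) : R :=
  \prod_(j < N) modc (w - foci L j) `^ expo L j.

(* The finite part of the lemniscatic domain. *)
Definition lemn_dom (R : realType) (N : nat) (L : lemniscatic R N) : set R[i] :=
  [set w | mu L < absU L w].

Definition conformal (R : realType) (A : set R[i]) (f : R[i] -> R[i]) : Prop :=
  forall z, A z -> derivable (f : R[i]^o -> R[i]^o) z 1 /\
                   'D_1 (f : R[i]^o -> R[i]^o) z != 0.

(* Everything is stated on the finite parts of the domains: the expansion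
   Phi(z) = z + O(1/z) says that Phi extends to a conformal map fixing oo.
   N is the number of components of E. *)
Definition lemniscatic_map (R : realType) (N : nat) (E : set R[i])
    (L : lemniscatic R N) (Phi : R[i] -> R[i]) : Prop :=
  [/\ mu L = capacity E,
      set_bij (~` E) (lemn_dom L) Phi,
      conformal (~` E) Phi &
      exists M r : R, 0 < r /\
        forall z, r < modc z -> modc (Phi z - z) <= M / modc z].

(* "The" lemniscatic map of E: uniqueness of L is up to relabelling the foci,
   and Phi is determined off E only. *)
Definition is_the_lemniscatic_map (R : realType) (N : nat) (E : set R[i])
    (L : lemniscatic R N) (Phi : R[i] -> R[i]) : Prop :=
  lemniscatic_map E L Phi /\
  forall (L' : lemniscatic R N) (Phi' : R[i] -> R[i]),
    lemniscatic_map E L' Phi' ->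
    [/\ exists s : 'S_N, forall j, foci L' j = foci L (s j) /\
                                   expo L' j = expo L (s j),
        mu L' = mu L &
        forall z, ~ E z -> Phi' z = Phi z].

(* Sequences alpha_1, alpha_2, ... are functions on nat whose value at 0 is
   irrelevant. *)
Definition admissible (R : realType) (N : nat) (L : lemniscatic R N)
    (alpha : nat -> R[i]) : Prop :=
  (forall j, (1 <= j)%N -> exists l, alpha j = foci L l) /\
  exists A : R, 0 < A /\ forall (k : nat) (l : 'I_N), (1 <= k)%N ->
    `| (count (fun j => alpha j == foci L l) (iota 1 k))%:R - k%:R * expo L l |
      <= A.

Definition green (R : realType) (N : nat) (L : lemniscatic R N)
    (Phi : R[i] -> R[i]) (z : R[i]) : R :=
  ln (absU L (Phi z)) - ln (mu L).

Definition level_curve (R : realType) (N : nat) (E : set R[i])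
    (L : lemniscatic R N) (Phi : R[i] -> R[i]) (lambda : R) : set R[i] :=
  [set z | ~ E z /\ green L Phi z = ln lambda].

(* E together with the points where the Green's function is below
   log lambda: the union of the interiors of the curves forming Gamma_lambda. *)
Definition level_int (R : realType) (N : nat) (E : set R[i])
    (L : lemniscatic R N) (Phi : R[i] -> R[i]) (lambda : R) : set R[i] :=
  [set z | E z \/ green L Phi z < ln lambda].

Definition level_ext (R : realType) (N : nat) (E : set R[i])
    (L : lemniscatic R N) (Phi : R[i] -> R[i]) (lambda : R) : set R[i] :=
  [set z | ~ E z /\ ln lambda < green L Phi z].

Definition C1 (R : realType) (f : R -> R) : Prop :=
  (forall t, derivable f t 1) /\ continuous (derive1 f).

(* Closed curves are parametrized by [0, 1]; the C^1 extension to all of R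
   avoids one-sided derivatives. *)
Definition closed_curve (R : realType) (gam : R -> R[i]) : Prop :=
  [/\ C1 (fun t => complex.Re (gam t)), C1 (fun t => complex.Im (gam t)) & gam 0 = gam 1].

Definition curve_deriv (R : realType) (gam : R -> R[i]) (t : R) : R[i] :=
  derive1 (fun t => complex.Re (gam t)) t +i*
  derive1 (fun t => complex.Im (gam t)) t.

Definition integral01 (R : realType) (f : R -> R[i]) : R[i] :=
  (\int[lebesgue_measure]_(t in `[0%R, 1%R]) complex.Re (f t)) +i*
  (\int[lebesgue_measure]_(t in `[0%R, 1%R]) complex.Im (f t)).

Definition cycle_integral (R : realType) (p : nat) (gam : 'I_p -> R -> R[i])
    (f : R[i] -> R[i]) : R[i] :=
  \sum_(i < p) integral01 (fun t => f (gam i t) * curve_deriv (gam i) t).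

Definition two_pi_i (R : realType) : R[i] := 0 +i* (2 * pi).

Definition winding (R : realType) (p : nat) (gam : 'I_p -> R -> R[i])
    (z : R[i]) : R[i] :=
  (two_pi_i R)^-1 * cycle_integral gam (fun zeta => (zeta - z)^-1).

(* Gamma_lambda may have several components (and is singular for finitely many
   lambda), so it is parametrized by a finite family of closed curves. *)
Definition positively_oriented (R : realType) (N : nat) (E : set R[i])
    (L : lemniscatic R N) (Phi : R[i] -> R[i]) (lambda : R)
    (p : nat) (gam : 'I_p -> R -> R[i]) : Prop :=
  [/\ forall i, closed_curve (gam i),
      \bigcup_(i in [set: 'I_p]) (gam i @` `[0%R, 1%R]) =
        level_curve E L Phi lambda,
      forall z, level_int E L Phi lambda z -> winding gam z = 1 &
      forall z, level_ext E L Phi lambda z -> winding gam z = 0].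

Definition upoly (R : realType) (alpha : nat -> R[i]) (k : nat) (w : R[i]) :
    R[i] :=
  \prod_(1 <= j < k.+1) (w - alpha j).

Definition is_faber_walsh (R : realType) (N : nat) (E : set R[i])
    (L : lemniscatic R N) (Phi : R[i] -> R[i]) (alpha : nat -> R[i])
    (k : nat) (b : R[i] -> R[i]) : Prop :=
  forall (lambda : R) (p : nat) (gam : 'I_p -> R -> R[i]),
    1 < lambda -> positively_oriented E L Phi lambda gam ->
    forall z, level_int E L Phi lambda z ->
      b z = (two_pi_i R)^-1 *
        cycle_integral gam (fun zeta => upoly alpha k (Phi zeta) / (zeta - z)).

Definition radial_set (R : realType) (n : nat) (C D : R) : set R[i] :=
  [set z | exists j : nat, exists r : R,
     [/\ (1 <= j <= n)%N, C <= r <= D &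
         z = expi (2 * pi * j%:R / n%:R) * r%:C]].

Definition radial_foci (R : realType) (n : nat) (C D : R) (j : nat) : R[i] :=
  expi (2 * pi * j.-1%:R / n%:R) *
  (((D `^ (n%:R / 2) + C `^ (n%:R / 2)) / 2) `^ (2 / n%:R))%:C.

(* Main.v *)
Require Import Defs.
From mathcomp Require Import all_boot all_order all_algebra all_fingroup.
From mathcomp Require Import complex.
From mathcomp Require Import all_classical all_reals all_analysis.
From mathcomp Require Import zify ring lra.
Import Order.TTheory GRing.Theory Num.Theory.
Import numFieldNormedType.Exports.
Local Open Scope classical_set_scope.
Local Open Scope ring_scope.
Local Open Scope complex_scope.
Set Implicit Arguments.
Unset Strict Implicit.
Unset Printing Implicit Defensive.

(** Put m = (C^n + D^n) / 2 and r = (D^n - C^n) / 4. The set E is the preimage under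
    z^n of the segment [m - 2r, m + 2r], and the Joukowski map
    jouk u = m + u + r^2/u maps the exterior of the circle |u| = r one-to-one onto
    the complement of that segment. Let J be the inverse map and - p0, - p1 the
    zeros of jouk, with p1 < r < p0; then the foci are the n-th roots of p0.

    The lemniscatic map is explicit: Phi(z) = z / (1 + p1 / J(z^n))^(1/n) with the
    principal root satisfies Phi(z)^n = J(z^n) + p0 and is a conformal bijection
    from the complement of E onto the set |w^n - p0| > r
    ([lemniscatic_map_radial]). Its parameter mu = r^(1/n) is the capacity of E
    ([capacity_preim_segment]), because the least norm of a monic polynomial of
    degree nk >= 1 on E is 2 r^k, and Vandermonde products are controlled by such
    norms ([capacity_eq]). By uniqueness, the given lemniscatic domain and map are
    these ones up to the order of the foci.

    Hence u_(nk)(Phi(z)) = (Phi(z)^n - p0)^k = J(z^n)^k, and for k >= 1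
    J(z^n)^k + (r^2 / J(z^n))^k = P_k(z^n), where P_k is the Chebyshev polynomial of
    the segment ([chebp_jouk]). On the level curve |J(z^n)| = rho the second term
    is of order 1 / rho, and the Cauchy integral of the polynomial P_k(z^n)
    reproduces it. So b_(nk)(z) = P_k(z^n) + O(1 / rho); since the Faber-Walsh
    polynomial does not depend on the curve, rho may tend to infinity and
    b_(nk)(z) = P_k(z^n) ([faber_walsh_chebyshev]). In this way no contour has to be
    deformed through the complement of E. What has to be known about the curves
    is their winding numbers ([positively_oriented_lcurve]): the n-th power of
    the curve is an ellipse around the origin, whose interior is star-shaped and
    whose exterior is invariant under dilations, so a homotopy along rays moves
    any interior point to 0 and the curve away from any exterior point.

    Finally P_k(z^n) is the unique Chebyshev polynomial of E
    ([cheb_preim_unique]): at the n-th roots of the k + 1 extremal points of P_k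
    it takes the values 2 r^k and - 2 r^k alternately, and a weighted alternating
    sum over these nodes annihilates every polynomial of degree below nk. A monic
    polynomial of degree nk whose norm is not larger must therefore agree with
    P_k(z^n) at all n (k + 1) nodes. *)

(** * Moduli, the unit circle and roots of unity *)

Section ComplexModulus.
Variable R : realType.
Implicit Types (x y z : R[i]) (t : R).

Lemma normE z : `|z| = (modc z)%:C.
Proof. by rewrite /modc normc_def. Qed.

Lemma modcE z : modc z = Num.sqrt (complex.Re z ^+ 2 + complex.Im z ^+ 2).
Proof. by rewrite /modc normc_def. Qed.

Lemma modc_ge0 z : 0 <= modc z.
Proof. by rewrite modcE sqrtr_ge0. Qed.

Lemma sqr_modc z : modc z ^+ 2 = complex.Re z ^+ 2 + complex.Im z ^+ 2.
Proof. by rewrite modcE sqr_sqrtr// addr_ge0 ?sqr_ge0. Qed.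

Lemma modcM x y : modc (x * y) = modc x * modc y.
Proof. by apply: complexI; rewrite rmorphM/= -!normE normrM. Qed.

Lemma modc0 : modc (0 : R[i]) = 0.
Proof. by rewrite /modc normr0. Qed.

Lemma modc1 : modc (1 : R[i]) = 1.
Proof. by rewrite /modc normr1. Qed.

Lemma modc_eq0 z : (modc z == 0) = (z == 0).
Proof. by rewrite -(inj_eq (@complexI _)) -normE normr_eq0. Qed.

Lemma modc_gt0 z : (0 < modc z) = (z != 0).
Proof. by rewrite lt_def modc_ge0 andbT modc_eq0. Qed.

Lemma modcX z k : modc (z ^+ k) = modc z ^+ k.
Proof. by apply: complexI; rewrite rmorphXn/= -!normE normrX. Qed.

Lemma modcN z : modc (- z) = modc z.
Proof. by rewrite /modc normrN. Qed.

Lemma modcV z : modc z^-1 = (modc z)^-1.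
Proof. by apply: complexI; rewrite fmorphV/= -!normE normfV. Qed.

Lemma modc_div x y : modc (x / y) = modc x / modc y.
Proof. by rewrite modcM modcV. Qed.

Lemma modc_distC x y : modc (x - y) = modc (y - x).
Proof. by rewrite /modc distrC. Qed.

Lemma ler_modcD x y : modc (x + y) <= modc x + modc y.
Proof. by rewrite -lecR rmorphD/= -!normE ler_normD. Qed.

Lemma lerB_modc x y : modc x - modc y <= modc (x - y).
Proof. by rewrite lerBlDr; apply: le_trans (ler_modcD _ _); rewrite subrK. Qed.

Lemma modcR t : modc t%:C = `|t|.
Proof. by rewrite modcE/= expr0n/= addr0 sqrtr_sqr. Qed.

Lemma modcR_ge0 t : 0 <= t -> modc t%:C = t.
Proof. by move=> t0; rewrite modcR ger0_norm. Qed.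

Lemma modc_prod (I : Type) (s : seq I) (P : pred I) (F : I -> R[i]) :
  modc (\prod_(i <- s | P i) F i) = \prod_(i <- s | P i) modc (F i).
Proof. exact: (big_morph _ modcM modc1). Qed.

Lemma ler_modc_sum (I : Type) (s : seq I) (P : pred I) (F : I -> R[i]) :
  modc (\sum_(i <- s | P i) F i) <= \sum_(i <- s | P i) modc (F i).
Proof.
elim/big_rec2: _ => [|i a b _ h]; first by rewrite modc0.
by apply: le_trans (ler_modcD _ _) _; rewrite lerD2l.
Qed.

Lemma Re_le_modc z : `|complex.Re z| <= modc z.
Proof.
by rewrite modcE -sqrtr_sqr ler_sqrt ?addr_ge0 ?sqr_ge0// lerDl sqr_ge0.
Qed.

Lemma Im_le_modc z : `|complex.Im z| <= modc z.
Proof.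
by rewrite modcE -sqrtr_sqr ler_sqrt ?addr_ge0 ?sqr_ge0// lerDr sqr_ge0.
Qed.

Lemma modc_le_ReIm z : modc z <= `|complex.Re z| + `|complex.Im z|.
Proof.
rewrite {1}[z]complexE -!modcR; apply: le_trans (ler_modcD _ _) _.
rewrite modcM lerD2l (_ : modc 'i%C = 1) ?mul1r//.
by rewrite modcE/= expr0n/= add0r expr1n sqrtr1.
Qed.

Lemma ReD x y : complex.Re (x + y) = complex.Re x + complex.Re y.
Proof. by case: x y => ? ? []. Qed.

Lemma ImD x y : complex.Im (x + y) = complex.Im x + complex.Im y.
Proof. by case: x y => ? ? []. Qed.

Lemma ReN x : complex.Re (- x) = - complex.Re x.
Proof. by case: x. Qed.

Lemma ImN x : complex.Im (- x) = - complex.Im x.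
Proof. by case: x. Qed.

Lemma ReM x y : complex.Re (x * y) =
  complex.Re x * complex.Re y - complex.Im x * complex.Im y.
Proof. by case: x y => ? ? []. Qed.

Lemma ImM x y : complex.Im (x * y) =
  complex.Re x * complex.Im y + complex.Im x * complex.Re y.
Proof. by case: x y => ? ? []. Qed.

Lemma Re_sum (I : Type) (s : seq I) (P : pred I) (F : I -> R[i]) :
  complex.Re (\sum_(i <- s | P i) F i) = \sum_(i <- s | P i) complex.Re (F i).
Proof. exact: (big_morph _ ReD (erefl _)). Qed.

Lemma Re_scale t x : complex.Re (t%:C * x) = t * complex.Re x.
Proof. by rewrite ReM/= mul0r subr0. Qed.

Lemma Im_scale t x : complex.Im (t%:C * x) = t * complex.Im x.
Proof. by rewrite ImM/= mul0r addr0. Qed.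

(** The equality case of Re z <= |z|; it turns an equality between averages
    into pointwise equalities. *)
Lemma modc_le_Re_eq z t : modc z <= t -> complex.Re z = t -> z = t%:C.
Proof.
move=> zt zE; have t0 : 0 <= t by apply: le_trans zt; apply: modc_ge0.
have : modc z ^+ 2 <= t ^+ 2 by rewrite ler_sqr ?nnegrE ?modc_ge0.
rewrite sqr_modc zE -[leRHS]addr0 lerD2l => h.
have /eqP := le_anti (introT andP (conj h (sqr_ge0 _))).
by rewrite sqrf_eq0 => /eqP zI; case: z zE zI {zt h} => a b /= -> ->.
Qed.

Lemma natC k : (k%:R : R)%:C = k%:R :> R[i].
Proof. exact: rmorph_nat. Qed.

Lemma realCD t s : (t + s)%:C = t%:C + s%:C :> R[i]. Proof. exact: rmorphD. Qed.
Lemma realCB t s : (t - s)%:C = t%:C - s%:C :> R[i]. Proof. exact: rmorphB. Qed.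
Lemma realCM t s : (t * s)%:C = t%:C * s%:C :> R[i]. Proof. exact: rmorphM. Qed.
Lemma realCX t k : (t ^+ k)%:C = t%:C ^+ k :> R[i]. Proof. exact: rmorphXn. Qed.
Lemma realCV t : (t^-1)%:C = t%:C^-1 :> R[i]. Proof. exact: fmorphV. Qed.

Lemma realC_eq0 t : (t%:C == 0 :> R[i]) = (t == 0).
Proof. exact: (inj_eq (@complexI _) t 0). Qed.

End ComplexModulus.

Section UnitCircle.
Variable R : realType.
Implicit Types (z : R[i]) (t s : R).

Lemma expi0 : expi (0 : R) = 1.
Proof. by rewrite /expi cos0 sin0. Qed.

Lemma expiD t s : expi (t + s) = expi t * expi s.
Proof.
by rewrite /expi cosD sinD; simpc; rewrite [X in _ +i* X]addrC.
Qed.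

Lemma expi_sum (k : nat) t : expi (k%:R * t) = expi t ^+ k.
Proof.
elim: k => [|k ih]; first by rewrite mul0r expi0 expr0.
by rewrite -natr1 mulrDl mul1r expiD ih exprSr.
Qed.

Lemma modc_expi t : modc (expi t) = 1.
Proof. by rewrite modcE/= cos2Dsin2 sqrtr1. Qed.

Lemma expi_neq0 t : expi t != 0.
Proof. by rewrite -modc_eq0 modc_expi oner_eq0. Qed.

Lemma expiN t : expi (- t) = (expi t)^-1.
Proof.
by apply: (mulfI (expi_neq0 t)); rewrite -expiD subrr expi0 mulfV// expi_neq0.
Qed.

Lemma expi2pi : expi (2 * pi : R) = 1.
Proof. by rewrite /expi mulr_natl cos2pi sin2pi. Qed.

Lemma expi_pi : expi (pi : R) = -1.
Proof. by rewrite /expi cospi sinpi; apply/eqP; rewrite eq_complex/= oppr0 !eqxx. Qed.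

Lemma expi_eq1 t : 0 <= t < 2 * pi -> expi t = 1 -> t = 0.
Proof.
move=> /andP[t0 t2] [ct st].
have [tpi|tpi] := leP t pi.
  by apply: cos_inj; rewrite ?in_itv/= ?lexx ?pi_ge0 ?t0 ?cos0.
have : 2 * pi - t = 0; last by lra.
apply: cos_inj; rewrite ?in_itv/= ?lexx ?pi_ge0//; first by lra.
by rewrite cos0 mulr_natl cosB cos2pi sin2pi ct mul0r addr0 mul1r.
Qed.

Lemma polar z : exists2 t, 0 <= t < 2 * pi & z = (modc z)%:C * expi t.
Proof.
have [->|z0] := eqVneq z 0.
  by exists 0; rewrite ?modc0 ?mul0r// lexx mulr_gt0// pi_gt0.
have m0 : 0 < modc z by rewrite modc_gt0.
pose x := complex.Re z / modc z; pose y := complex.Im z / modc z.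
have xy : x ^+ 2 + y ^+ 2 = 1.
  by rewrite /x /y !expr_div_n -mulrDl -sqr_modc divff// expf_neq0// gt_eqF.
have zE : z = (modc z)%:C * (x +i* y).
  rewrite /x /y; case: (z) m0 => a b m0; simpc.
  by rewrite /= !mulrA ![modc _ * _]mulrC !mulfK// gt_eqF.
have x1 : -1 <= x <= 1.
  by rewrite -ler_norml -(@ler_sqr _ _ 1) ?nnegrE// expr1n real_normK ?num_real//
    -xy lerDl sqr_ge0.
have aC : cos (acos x) = x by rewrite acosK// in_itv.
have aS : sin (acos x) = `|y|.
  by rewrite sin_acos// -[1]xy addrAC subrr add0r sqrtr_sqr.
have a0 := acos_ge0 x1; have api := acos_lepi x1; have pi0 := pi_gt0 R.
have [y0|y0] := leP 0 y.
  exists (acos x); first by apply/andP; split=> //; lra.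
  by rewrite {1}zE /expi aC aS ger0_norm.
exists (2 * pi - acos x).
  have : 0 < acos x; last by lra.
  rewrite lt_def a0 andbT; apply: contraTneq y0 => ax.
  by rewrite -leNgt; move: aS; rewrite ax sin0 => /esym/normr0_eq0->.
rewrite {1}zE /expi mulr_natl cosB sinB cos2pi sin2pi aC aS ltr0_norm//.
by rewrite !mul0r !mul1r addr0 sub0r opprK.
Qed.

Definition omega (n : nat) : R[i] := expi (2 * pi / n%:R).

Lemma omegaX n k : omega n ^+ k = expi (2 * pi * k%:R / n%:R).
Proof. by rewrite -expi_sum mulrC mulrAC. Qed.

Lemma omega_prim n : (0 < n)%N -> n.-primitive_root (omega n).
Proof.
move=> n0; apply/andP; split=> //; apply/forallP => i; apply/eqP.
have n0' : (0 : R) < n%:R by rewrite ltr0n.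
have pi0 := pi_gt0 R.
apply/unity_rootP/eqP => [|->]; last first.
  by rewrite omegaX mulfK ?expi2pi// gt_eqF.
rewrite omegaX => h; move: (ltn_ord i) h; rewrite leq_eqVlt.
move=> /predU1P[->//|lt_in] /expi_eq1 h; exfalso.
have : 2 * pi * i.+1%:R / n%:R = 0 :> R.
  apply: h; rewrite divr_ge0 ?mulr_ge0 ?pi_ge0//=.
  by rewrite ltr_pdivrMr// ltr_pM2l ?mulr_gt0// ltr_nat.
by apply/eqP; rewrite gt_eqF// divr_gt0// !mulr_gt0// ltr0n.
Qed.

Lemma omega_expn n : (0 < n)%N -> omega n ^+ n = 1.
Proof. by move=> n0; rewrite (prim_expr_order (omega_prim n0)). Qed.

Lemma omega_neq0 n : omega n != 0.
Proof. exact: expi_neq0. Qed.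

(** All n-th roots arise from one of them by rotation: this is how both the
    radial set and the level curves acquire their n-fold symmetry. *)
Lemma eq_expr_omega n (x y : R[i]) : (0 < n)%N -> x ^+ n = y ^+ n ->
  exists l : 'I_n, x = y * omega n ^+ l.
Proof.
move=> n0 xy; have [y0|y0] := eqVneq y 0.
  exists (Ordinal n0); move/eqP: xy; rewrite y0 expr0n eqn0Ngt n0/= expf_eq0 n0/=.
  by move=> /eqP ->; rewrite mul0r.
have h : (x / y) ^+ n = 1 by rewrite expr_div_n xy divff// expf_neq0.
have [l lE] := prim_rootP (omega_prim n0) h.
by exists l; rewrite -lE mulrC divfK.
Qed.

Lemma prod_sub_omega n (w a : R[i]) : (0 < n)%N ->
  \prod_(l < n) (w - a * omega n ^+ l) = w ^+ n - a ^+ n.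
Proof.
move=> n0; have [->|a0] := eqVneq a 0.
  under eq_bigr do rewrite mul0r subr0.
  by rewrite prodr_const card_ord expr0n eqn0Ngt n0 subr0.
have /(congr1 (horner^~ (w / a))) := factor_Xn_sub_1 (omega_prim n0).
rewrite horner_prod big_mkord !hornerE => h.
rewrite -[w in RHS](divfK a0) exprMn -[X in _ - X]mul1r -mulrBl -h.
have -> : a ^+ n = \prod_(l < n) a by rewrite prodr_const card_ord.
rewrite -big_split/=.
by apply: eq_bigr => i _; rewrite !hornerE mulrBl divfK// [_ * a]mulrC.
Qed.

End UnitCircle.

(** * The Joukowski map *)

Section Joukowski.
Variables (R : realType) (m r : R).
Implicit Types (u v w z : R[i]) (t x : R).

Definition jouk u : R[i] := m%:C + u + (r ^+ 2)%:C / u.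

Definition segment : set R[i] :=
  [set z | exists2 x : R, m - 2 * r <= x <= m + 2 * r & z = x%:C].

(** The images of circles under the Joukowski map are level sets of this sum of
    distances: ellipses with common foci. *)
Definition focal_sum z : R :=
  modc (z - (m - 2 * r)%:C) + modc (z - (m + 2 * r)%:C).

(** The branch with values outside the circle of radius r; the value 0 on the
    segment is arbitrary. *)
Definition jouk_inv z : R[i] := xget 0 [set u | r < modc u /\ jouk u = z].

(** The second factor is the difference quotient of the map. It never vanishes
    outside the closed disc, which gives injectivity there as well as the
    continuity and the derivative of the inverse. *)
Lemma joukB u v : u != 0 -> v != 0 ->
  jouk u - jouk v = (u - v) * (1 - (r ^+ 2)%:C / (u * v)).
Proof. by move=> u0 v0; rewrite /jouk; field; rewrite u0 v0. Qed.

Hypothesis r0 : 0 < r.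

Lemma neq0_gtr u : r < modc u -> u != 0.
Proof. by move=> h; rewrite -modc_gt0; exact: lt_trans h. Qed.

Lemma jouk_eq u v : u != 0 -> v != 0 -> jouk u = jouk v ->
  u = v \/ modc u * modc v = r ^+ 2.
Proof.
move=> u0 v0 /eqP; rewrite -subr_eq0 joukB// mulf_eq0 !subr_eq0.
case/orP=> /eqP; first by left.
move=> /(congr1 ( *%R^~ (u * v))); rewrite mul1r divfK ?mulf_neq0// => h; right.
by rewrite -modcM h modcR ger0_norm// sqr_ge0.
Qed.

Lemma jouk_inj u v : r < modc u -> r < modc v -> jouk u = jouk v -> u = v.
Proof.
move=> hu hv /jouk_eq[] => [||//|h]; rewrite ?neq0_gtr//.
suff : r ^+ 2 < modc u * modc v by rewrite h ltxx.
by rewrite expr2 ltr_pM // ltW.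
Qed.

Lemma jouk_eqr t : jouk (r%:C * expi t) = (m + 2 * r * cos t)%:C.
Proof.
rewrite /jouk invfM -expiN /expi cosN sinN !mulrA realCX expr2.
rewrite mulfK ?realC_eq0 ?gt_eqF//; simpc.
by congr (_ +i* _); ring.
Qed.

Lemma jouk_seg t : segment (jouk (r%:C * expi t)).
Proof.
exists (m + 2 * r * cos t); last exact: jouk_eqr.
have h1 : 0 <= r * (1 + cos t).
  by rewrite mulr_ge0 ?(ltW r0)//; have := cos_geN1 t; lra.
have h2 : 0 <= r * (1 - cos t).
  by rewrite mulr_ge0 ?(ltW r0)//; have := cos_le1 t; lra.
by apply/andP; split; lra.
Qed.

(** A point of the segment is jouk of two conjugate points of the circle
    |u| = r; so it has no preimage off that circle. *)
Lemma seg_jouk z : segment z ->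
  exists2 t, 0 <= t <= pi & z = jouk (r%:C * expi t).
Proof.
move=> [x /andP[x1 x2] ->].
have yb : -1 <= (x - m) / (2 * r) <= 1.
  by rewrite ler_pdivlMr ?ler_pdivrMr ?mulr_gt0//; apply/andP; split; lra.
exists (acos ((x - m) / (2 * r))); first by rewrite acos_ge0// acos_lepi.
rewrite jouk_eqr acosK ?in_itv//=; congr (_%:C).
by rewrite [_ * (_ / _)]mulrC divfK ?gt_eqF ?mulr_gt0// addrC subrK.
Qed.

Lemma jouk_Nseg u : r < modc u -> ~ segment (jouk u).
Proof.
move=> hu /seg_jouk[t _] /jouk_eq[].
- exact: neq0_gtr.
- by rewrite mulf_neq0 ?expi_neq0// realC_eq0 gt_eqF.
- by move=> uE; move: hu; rewrite uE modcM modc_expi modcR_ge0 ?mulr1 ?ltxx// ltW.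
rewrite modcM modc_expi modcR_ge0 ?mulr1 1?ltW// expr2 => /mulIf h.
by move: hu; rewrite h ?ltxx// gt_eqF.
Qed.

(** The roots u and r^2/u of the quadratic equation jouk u = z either lie on
    different sides of the circle |u| = r, or both lie on it; in the latter case
    z belongs to the segment. *)
Lemma jouk_surj z : ~ segment z -> exists u, r < modc u /\ jouk u = z.
Proof.
move=> Nz; pose b := z - m%:C; pose d := sqrtc (b ^+ 2 - 4 * (r ^+ 2)%:C).
pose u := (b + d) / 2; pose v := (b - d) / 2.
have uv : u * v = (r ^+ 2)%:C.
  have dd : d ^+ 2 = b ^+ 2 - 4 * (r ^+ 2)%:C by rewrite sqr_sqrtc.
  have -> : u * v = (b ^+ 2 - d ^+ 2) / 4 by rewrite /u /v; field.
  by rewrite dd; field.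
have r20 : (r ^+ 2)%:C != 0 :> R[i] by rewrite realC_eq0 sqrf_eq0 gt_eqF.
have u0 : u != 0 by apply: contra_neq r20 => u0; rewrite -uv u0 mul0r.
have v0 : v != 0 by apply: contra_neq r20 => v0; rewrite -uv v0 mulr0.
have uvb : u + v = b by rewrite /u /v; field.
have ju : jouk u = z.
  by rewrite /jouk -uv [u * v]mulrC mulfK// -addrA uvb addrC subrK.
have jv : jouk v = z.
  by rewrite /jouk -uv mulfK// -addrA [v + u]addrC uvb addrC subrK.
have [hu|hu] := ltP r (modc u); first by exists u.
have [hv|hv] := ltP r (modc v); first by exists v.
have muv : modc u * modc v = r ^+ 2.
  by rewrite -modcM uv modcR ger0_norm// sqr_ge0.
have u_gt0 : 0 < modc u by rewrite modc_gt0.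
have v_gt0 : 0 < modc v by rewrite modc_gt0.
have mu : modc u = r by nra.
exfalso; apply: Nz; rewrite -ju; have [t _ ->] := polar u; rewrite mu.
exact: jouk_seg.
Qed.

Lemma jouk_invP z : ~ segment z ->
  r < modc (jouk_inv z) /\ jouk (jouk_inv z) = z.
Proof. by move=> /jouk_surj/(@xgetPex _ 0 [set u | r < modc u /\ jouk u = z]). Qed.

Lemma joukK u : r < modc u -> jouk_inv (jouk u) = u.
Proof.
move=> hu; have [h e] := jouk_invP (jouk_Nseg hu).
exact: jouk_inj.
Qed.

(** Circles go to ellipses with foci m - 2r and m + 2r: the differences from the
    foci, multiplied by u, are the squares of u + r and u - r, and the
    parallelogram law adds up their moduli. *)
Lemma focal_sum_jouk u : u != 0 ->
  focal_sum (jouk u) = 2 * (modc u + r ^+ 2 / modc u).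
Proof.
move=> u0; have mu0 : 0 < modc u by rewrite modc_gt0.
rewrite /focal_sum.
have -> : jouk u - (m - 2 * r)%:C = (u + r%:C) ^+ 2 / u.
  by rewrite /jouk realCB realCM realCX natC; field.
have -> : jouk u - (m + 2 * r)%:C = (u - r%:C) ^+ 2 / u.
  by rewrite /jouk realCD realCM realCX natC; field.
rewrite !modc_div !modcX -mulrDl.
have -> : modc (u + r%:C) ^+ 2 + modc (u - r%:C) ^+ 2 = 2 * (modc u ^+ 2 + r ^+ 2).
  rewrite !sqr_modc; case: (u) => a b /=; rewrite oppr0 !addr0; ring.
by field; rewrite gt_eqF.
Qed.

Lemma focal_sum_segment z : segment z -> focal_sum z = 4 * r.
Proof.
move=> /seg_jouk[t _ ->]; rewrite focal_sum_jouk.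
  rewrite modcM modc_expi mulr1 modcR_ge0 ?(ltW r0)//.
  by field; rewrite gt_eqF.
by rewrite mulf_neq0 ?expi_neq0// realC_eq0 gt_eqF.
Qed.

(** Nested circles have nested images: the image of the circle of radius a has
    the major semi-axis a + r^2/a. *)
Lemma focal_axis_lt (a b : R) : r <= a -> r < b ->
  (a + r ^+ 2 / a < b + r ^+ 2 / b) = (a < b).
Proof.
move=> ra rb; have a0 : 0 < a := lt_le_trans r0 ra.
have b0 : 0 < b := lt_trans r0 rb.
rewrite -subr_gt0 -[RHS]subr_gt0.
have -> : b + r ^+ 2 / b - (a + r ^+ 2 / a) = (b - a) * (1 - r ^+ 2 / (a * b)).
  by field; rewrite !gt_eqF.
rewrite pmulr_lgt0// subr_gt0 ltr_pdivrMr ?mulr_gt0// mul1r expr2.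
by rewrite (@le_lt_trans _ _ (a * r)) ?ler_pM2r ?ltr_pM2l.
Qed.

Lemma focal_sum_scale t z : 0 <= t <= 1 ->
  focal_sum (t%:C * z) <= t * focal_sum z + (1 - t) * focal_sum 0.
Proof.
move=> /andP[t0 t1]; rewrite /focal_sum.
have h (c : R[i]) : modc (t%:C * z - c) <= t * modc (z - c) + (1 - t) * modc (0 - c).
  have -> : t%:C * z - c = t%:C * (z - c) + (1 - t)%:C * (0 - c).
    by rewrite realCB; ring.
  apply: le_trans (ler_modcD _ _) _.
  by rewrite !modcM !modcR_ge0// subr_ge0.
by have := h (m - 2 * r)%:C; have := h (m + 2 * r)%:C; lra.
Qed.

Lemma focal_sum_lip z w : focal_sum z - focal_sum w <= 2 * modc (z - w).
Proof.
rewrite /focal_sum.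
have h (c : R[i]) : modc (z - c) - modc (w - c) <= modc (z - w).
  by apply: le_trans (lerB_modc _ _) _; rewrite opprB addrA subrK.
by have := h (m - 2 * r)%:C; have := h (m + 2 * r)%:C; lra.
Qed.

Lemma modc_jouk u : r < modc u -> modc (jouk u - m%:C) <= 2 * modc u.
Proof.
move=> hu; have -> : jouk u - m%:C = u + (r ^+ 2)%:C / u by rewrite /jouk; ring.
apply: le_trans (ler_modcD _ _) _.
rewrite modc_div modcR ger0_norm ?sqr_ge0// mulr_natl mulr2n lerD2l.
have u0 : 0 < modc u := lt_trans r0 hu.
by rewrite ler_pdivrMr// -expr2 ler_sqr ?nnegrE ltW.
Qed.

End Joukowski.

(** * Chebyshev polynomials of the preimage of a segment under z^n *)

Section ChebyshevSegment.
Variables (R : realType) (m r : R).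
Implicit Types (u z : R[i]) (k : nat).

Local Notation P := {poly R[i]}.

(** Two consecutive terms at a time, because the recurrence has order two. The
    first one is 2 and not 1: chebp k is monic from k = 1 on only. *)
Fixpoint cheb_pair k : P * P :=
  if k is k'.+1 then
    let: (a, b) := cheb_pair k' in (b, ('X - m%:C%:P) * b - (r ^+ 2)%:C *: a)
  else (2%:P, 'X - m%:C%:P).

Definition chebp k : P := (cheb_pair k).1.

Lemma chebpSS k :
  chebp k.+2 = ('X - m%:C%:P) * chebp k.+1 - (r ^+ 2)%:C *: chebp k.
Proof. by rewrite /chebp /=; case: (cheb_pair k). Qed.

(** The recurrence is the one of the sequence k |-> u^k + (r^2/u)^k, because
    u and r^2/u are the roots of T^2 - (z - m) T + r^2 with z = jouk u. *)
Lemma chebp_jouk k u : u != 0 ->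
  (chebp k).[jouk m r u] = u ^+ k + ((r ^+ 2)%:C / u) ^+ k.
Proof.
move=> u0.
suff: (chebp k).[jouk m r u] = u ^+ k + ((r ^+ 2)%:C / u) ^+ k /\
  (chebp k.+1).[jouk m r u] = u ^+ k.+1 + ((r ^+ 2)%:C / u) ^+ k.+1 by case.
elim: k => [|k [ih1 ih2]]; first by rewrite /chebp /= !hornerE /jouk; split; ring.
split=> //; rewrite chebpSS !hornerE ih1 ih2 /jouk !exprS; field.
exact: u0.
Qed.

Lemma chebp_monic_size k : chebp k.+1 \is monic /\ size (chebp k.+1) = k.+2.
Proof.
suff: [/\ chebp k.+1 \is monic, size (chebp k.+1) = k.+2 &
  (size (chebp k) <= k.+1)%N] by case.
elim: k => [|k [mo sz le]].
  by rewrite /chebp /= monicXsubC size_XsubC size_polyC leq_b1.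
rewrite sz; have szX : size (('X - m%:C%:P) * chebp k.+1) = k.+3.
  by rewrite size_monicM ?monicXsubC ?size_XsubC ?sz ?monic_neq0.
have lt : (size (- ((r ^+ 2)%:C *: chebp k)) < k.+3)%N.
  by rewrite size_polyN (leq_ltn_trans (size_scale_leq _ _))// ltnS leqW.
split=> //; last by rewrite chebpSS size_polyDl szX.
by rewrite monicE chebpSS lead_coefDl ?szX// -monicE monicMl ?monicXsubC.
Qed.

End ChebyshevSegment.

Section RootSums.
Variable R : realType.

Lemma sum_prim_root (n e : nat) (w : R[i]) : n.-primitive_root w ->
  ~~ (n %| e)%N -> \sum_(j < n) w ^+ (e * j) = 0.
Proof.
move=> pw ne; have w1 : w ^+ e - 1 != 0 by rewrite subr_eq0 -(prim_order_dvd pw).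
apply: (mulfI w1); rewrite mulr0.
under eq_bigr do rewrite exprM.
by rewrite -subrX1 -exprM mulnC exprM (prim_expr_order pw) expr1n subrr.
Qed.

End RootSums.

Section ExtremalPoints.
Variables (R : realType) (m r : R).
Hypothesis r0 : 0 < r.
Variable n : nat.
Hypothesis n0 : (0 < n)%N.
Implicit Types (u z : R[i]) (k : nat) (p q : {poly R[i]}).

Definition preim_segment : set R[i] := [set z | segment m r (z ^+ n)].

Section Fixed_k.
Variable k : nat.
Hypothesis k0 : (0 < k)%N.

Let eta : R[i] := omega R (2 * k).

Let eta_prim : (2 * k).-primitive_root eta.
Proof. by apply: omega_prim; rewrite muln_gt0. Qed.

Let eta0 : eta != 0. Proof. exact: omega_neq0. Qed.

Lemma omega_half : eta ^+ k = -1.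
Proof.
rewrite omegaX natrM -expi_pi; congr expi; field.
by rewrite pnatr_eq0 -lt0n.
Qed.

(** The points of the segment where the Chebyshev polynomial of degree k takes
    its extreme values. With j running over a full period 2k each interior one
    is listed twice and each endpoint once, which are the trapezoidal weights;
    no separate treatment of the endpoints is needed. *)
Definition extr (j : nat) : R[i] := jouk m r (r%:C * eta ^+ j).

Lemma extrE (j : nat) : extr j = (m + 2 * r * cos (2 * pi * j%:R / (2 * k)%:R))%:C.
Proof. by rewrite /extr omegaX jouk_eqr. Qed.

Lemma extrD (j : nat) : extr j = m%:C + r%:C * eta ^+ j + r%:C * eta ^- j.
Proof.
rewrite /extr /jouk realCX; congr (_ + _); field.
by rewrite expf_neq0// realC_eq0 gt_eqF.
Qed.

(** Multiplication by extr j shifts the frequency e by at most one, so that it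
    stays strictly between 0 and 2k, where sums over roots of unity vanish. *)
Let extr_sum (i e : nat) : (i < e)%N -> (i + e < 2 * k)%N ->
  \sum_(j < 2 * k) extr j ^+ i * eta ^+ (e * j) = 0.
Proof.
elim: i e => [|i ih] e lt1 lt2.
  under eq_bigr do rewrite expr0 mul1r.
  by apply: sum_prim_root => //; rewrite gtnNdvd.
have e0 : (0 < e)%N by apply: leq_trans lt1.
transitivity (m%:C * (\sum_(j < 2 * k) extr j ^+ i * eta ^+ (e * j)) +
  r%:C * (\sum_(j < 2 * k) extr j ^+ i * eta ^+ (e.+1 * j)) +
  r%:C * (\sum_(j < 2 * k) extr j ^+ i * eta ^+ (e.-1 * j))).
  rewrite !mulr_sumr -!big_split/=; apply: eq_bigr => j _.
  have E1 : eta ^+ (e.+1 * j) = eta ^+ (e * j) * eta ^+ j by rewrite (mulSn e) addnC exprD.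
  have E2 : eta ^+ (e.-1 * j) = eta ^+ (e * j) * eta ^- j.
    case: (e) e0 => // e' _.
    by rewrite (mulSn e') exprD [eta ^+ j * _]mulrC mulfK ?expf_neq0.
  by rewrite E1 E2 exprS {1}extrD; ring.
by rewrite !ih ?mulr0 ?addr0//; lia.
Qed.

(** The sign (-1)^j is the wave of frequency k, so that alternating sums over the
    extremal points annihilate the powers below the k-th. *)
Lemma extr_orth (i : nat) : (i < k)%N ->
  \sum_(j < 2 * k) (-1) ^+ j * extr j ^+ i = 0.
Proof.
move=> ik; rewrite -[RHS](@extr_sum i k)//; last by rewrite mul2n -addnn ltn_add2r.
by apply: eq_bigr => j _; rewrite exprM omega_half mulrC.
Qed.

Definition node (j l : nat) : R[i] := n.-root (extr j) * omega R n ^+ l.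

Lemma node_expn (j l : nat) : node j l ^+ n = extr j.
Proof. by rewrite /node exprMn rootCK// exprAC omega_expn// expr1n mulr1. Qed.

Lemma node_in (j l : nat) : preim_segment (node j l).
Proof. by rewrite /preim_segment/= node_expn /extr omegaX; exact: jouk_seg. Qed.

(** A power z^i with i not divisible by n cancels under rotations by roots of
    unity; the other ones are powers of z^n and cancel over the extremal
    points. *)
Lemma node_orth q : (size q <= n * k)%N ->
  \sum_(j < 2 * k) \sum_(l < n) (-1) ^+ j * q.[node j l] = 0.
Proof.
move=> sq.
under eq_bigr do under eq_bigr do rewrite (horner_coef_wide _ sq) mulr_sumr.
under eq_bigr do rewrite exchange_big/=.
rewrite exchange_big/= big1// => i _.
transitivity (q`_i * ((\sum_(j < 2 * k) (-1) ^+ j * n.-root (extr j) ^+ i) *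
   (\sum_(l < n) omega R n ^+ (i * l)))).
  rewrite mulr_suml mulr_sumr; apply: eq_bigr => j _.
  rewrite !mulr_sumr; apply: eq_bigr => l _.
  by rewrite /node exprMn -exprM [(l * i)%N]mulnC; ring.
have [/dvdnP[i' iE]|ni] := boolP (n %| i)%N; last first.
  by rewrite (sum_prim_root (omega_prim R n0) ni) !mulr0.
rewrite [X in _ * (X * _)](_ : _ = 0) ?mul0r ?mulr0//.
transitivity (\sum_(j < 2 * k) (-1) ^+ j * extr j ^+ i').
  by apply: eq_bigr => j _; rewrite iE (mulnC i') exprM rootCK.
apply: extr_orth; by have := ltn_ord i; rewrite iE mulnC ltn_pmul2l.
Qed.

Hypothesis rm : 2 * r < m.

Lemma extr_neq0 (j : nat) : extr j != 0.
Proof.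
rewrite extrE realC_eq0 gt_eqF//.
have := cos_geN1 (2 * pi * j%:R / (2 * k)%:R : R); set c := cos _ => c1.
have : 0 <= r * (1 + c) by rewrite mulr_ge0 ?(ltW r0)// -lerBlDl sub0r.
by move: rm; lra.
Qed.

Lemma node_inj : injective (fun jl : 'I_k.+1 * 'I_n => node jl.1 jl.2).
Proof.
move=> [j l] [j' l'] /= e.
have k0' : (0 : R) < k%:R by rewrite ltr0n.
have th (i : 'I_k.+1) : 0 <= 2 * pi * i%:R / (2 * k)%:R <= (pi : R).
  rewrite divr_ge0 ?mulr_ge0 ?pi_ge0//= ler_pdivrMr ?ltr0n ?muln_gt0//.
  rewrite natrM [2 * pi]mulrC -mulrA ler_pM2l ?pi_gt0// ler_pM2l//.
  by rewrite ler_nat -ltnS.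
have jj : j = j'.
  have := congr1 (fun x : R[i] => x ^+ n) e; rewrite /= !node_expn !extrE.
  move=> /(@complexI _)/addrI/mulfI h.
  have : 2 * pi * j%:R / (2 * k)%:R = 2 * pi * j'%:R / (2 * k)%:R :> R.
    by apply: cos_inj; rewrite ?in_itv/= ?th// h// gt_eqF// mulr_gt0.
  move=> /(mulIf _) h'; apply: val_inj; apply/eqP; rewrite -(eqr_nat R); apply/eqP.
  have {}h' := h' _; apply: (@mulfI _ (2 * pi)); last apply: h'.
    by rewrite gt_eqF// mulr_gt0// pi_gt0.
  by rewrite invr_eq0 pnatr_eq0 -lt0n muln_gt0.
move: e; rewrite /node -jj => /mulfI e.
have /e/eqP : n.-root (extr j) != 0 by rewrite rootC_eq0// extr_neq0.
rewrite (eq_prim_root_expr (omega_prim R n0)) !modn_small// => /eqP ll.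
by congr pair; exact: val_inj.
Qed.

Definition cheb_preim : {poly R[i]} := chebp m r k \Po 'X^n.

Lemma cheb_preimE z : cheb_preim.[z] = (chebp m r k).[z ^+ n].
Proof. by rewrite horner_comp hornerXn. Qed.

Lemma cheb_preim_monic : cheb_preim \is monic.
Proof.
have [mo sz] := chebp_monic_size m r k.-1; rewrite prednK// in mo sz.
by rewrite monicE lead_coef_comp ?size_polyXn ?ltnS// lead_coefXn expr1n mulr1 (monicP mo).
Qed.

Lemma size_cheb_preim : size cheb_preim = (n * k).+1.
Proof.
have [mo sz] := chebp_monic_size m r k.-1; rewrite prednK// in mo sz.
rewrite -[LHS]prednK; first by rewrite size_comp_poly sz size_polyXn/= mulnC.
by rewrite lt0n size_poly_eq0 monic_neq0// cheb_preim_monic.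
Qed.

Lemma cheb_preim_le z : preim_segment z -> modc cheb_preim.[z] <= 2 * r ^+ k.
Proof.
move=> /(seg_jouk r0)[t _ zE].
have u0 : r%:C * expi t != 0 by rewrite mulf_neq0 ?expi_neq0// realC_eq0 gt_eqF.
rewrite cheb_preimE zE chebp_jouk//; apply: le_trans (ler_modcD _ _) _.
rewrite !modcX modc_div !modcM modc_expi mulr1 !modcR_ge0 ?sqr_ge0 ?(ltW r0)//.
by rewrite expr2 mulfK ?gt_eqF// mulr_natl mulr2n.
Qed.

Lemma cheb_preim_node (j l : nat) : cheb_preim.[node j l] = (-1) ^+ j * (2 * r ^+ k)%:C.
Proof.
have u0 : r%:C * eta ^+ j != 0 by rewrite mulf_neq0 ?expf_neq0// realC_eq0 gt_eqF.
rewrite cheb_preimE node_expn chebp_jouk//.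
have -> : (r ^+ 2)%:C / (r%:C * eta ^+ j) = r%:C * eta ^- j.
  by rewrite realCX; field; rewrite expf_neq0// realC_eq0 gt_eqF.
have s : eta ^+ j ^+ k = (-1) ^+ j by rewrite exprAC omega_half.
rewrite !exprMn exprVn s -signr_odd; case: (odd j); rewrite ?expr1 ?expr0 ?invrN1 ?invr1;
by rewrite realCM realCX natC; ring.
Qed.

(** If p is no larger than the equioscillating polynomial on the preimage,
    then the alternating average of p over the nodes, which only sees the
    leading coefficient, forces p to agree with it at n (k + 1) points. *)
Lemma cheb_preim_unique p : p \is monic -> size p = (n * k).+1 ->
  (forall z, preim_segment z -> modc p.[z] <= 2 * r ^+ k) -> p = cheb_preim.
Proof.
move=> mp sp ple; set T := cheb_preim; pose M := 2 * r ^+ k.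
have sq : (size (p - T)%R <= n * k)%N.
  apply/leq_sizeP => j; rewrite leq_eqVlt => /predU1P[<-|lt].
    have /monicP := mp; have /monicP := cheb_preim_monic.
    rewrite /lead_coef sp size_cheb_preim/= coefB => -> ->.
    exact: subrr.
  by rewrite coefB !nth_default ?subrr ?sp ?size_cheb_preim.
pose f (j l : nat) := (-1) ^+ j * p.[node j l].
have fle j l : modc (f j l) <= M.
  by rewrite /f modcM modcX modcN modc1 expr1n mul1r; exact/ple/node_in.
have sum0 : \sum_(j < 2 * k) \sum_(l < n) (M - complex.Re (f j l)) = 0.
  have := congr1 (@complex.Re R) (node_orth sq); rewrite Re_sum.
  under eq_bigr do rewrite Re_sum.
  rewrite [complex.Re 0]/= => h; apply/eqP; rewrite -oppr_eq0 -[X in _ == X]h.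
  rewrite -sumrN; apply/eqP; apply: eq_bigr => j _.
  rewrite -sumrN; apply: eq_bigr => l _.
  rewrite hornerD hornerN cheb_preim_node mulrBr mulrA -exprMn mulrNN mulr1 expr1n mul1r.
  by rewrite ReD ReN/= opprB.
have fE (j l : nat) : (j < 2 * k)%N -> (l < n)%N -> f j l = M%:C.
  move=> lj ll; apply: modc_le_Re_eq => //; apply/esym/eqP; rewrite -subr_eq0.
  have ge0 j' l' : 0 <= M - complex.Re (f j' l').
    rewrite subr_ge0; apply: le_trans (fle j' l').
    by apply: le_trans (Re_le_modc _); exact: ler_norm.
  move/eqP: sum0; rewrite psumr_eq0 => [/allP h|j' _]; last by rewrite sumr_ge0.
  have := h (Ordinal lj) (mem_index_enum _); rewrite /= psumr_eq0// => /allP{}h.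
  exact: (h (Ordinal ll) (mem_index_enum _)).
apply/eqP; rewrite -subr_eq0; apply/negPn/negP => pT.
pose rs := [seq node jl.1 jl.2 | jl : 'I_k.+1 * 'I_n].
have rs_root : all (root (p - T)) rs.
  apply/allP => _ /mapP[[j l] _ ->]; apply/rootP => /=.
  have jk : (j < 2 * k)%N by have := ltn_ord j; move: k0; lia.
  rewrite hornerD hornerN cheb_preim_node -/M -(fE j l)// /f mulrA -exprMn.
  by rewrite mulrNN mulr1 expr1n mul1r subrr.
have rs_uniq : uniq rs by rewrite map_inj_uniq ?enum_uniq//; exact: node_inj.
have := max_poly_roots pT rs_root rs_uniq.
rewrite size_map -cardT card_prod !card_ord ltnNge (leq_trans sq)//.
by rewrite mulnC leq_mul2r leqnSn orbT.
Qed.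

(** The same comparison bounds the norm of every monic polynomial from below,
    which is the lower estimate of the capacity. *)
Lemma cheb_preim_norm_ge p : p \is monic -> size p = (n * k).+1 ->
  exists2 z, preim_segment z & 2 * r ^+ k <= modc p.[z].
Proof.
move=> mp sp; apply: contrapT => h.
have lt z : preim_segment z -> modc p.[z] < 2 * r ^+ k.
  by move=> zE; rewrite ltNge; apply/negP => le; apply: h; exists z.
have pE : p = cheb_preim by apply: cheb_preim_unique => // z /lt/ltW.
have := lt _ (node_in 0 0); rewrite pE cheb_preim_node expr0 mul1r modcR_ge0 ?ltxx//.
by rewrite mulr_ge0// exprn_ge0// ltW.
Qed.

End Fixed_k.

Lemma preim_segment_bound z : preim_segment z -> modc z <= 1 + `|m| + 2 * r.
Proof.
move=> [x /andP[x1 x2] zE].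
have zx : modc z ^+ n = `|x| by rewrite -modcX zE modcR.
have [z1|z1] := leP (modc z) 1.
  by have := normr_ge0 m; have := r0; lra.
have : modc z <= `|x| by rewrite -zx -[leLHS]expr1 ler_weXn2l// ltW.
have : `|x| <= `|m| + 2 * r.
  by rewrite ler_norml; have := ler_norm m; have := ler_norm (- m); rewrite normrN; lra.
by lra.
Qed.

Lemma preim_segment_neq0 : preim_segment !=set0.
Proof. by exists (node 1 0 0); apply: node_in. Qed.

Lemma poly_bounded_preim p :
  exists K, forall z, preim_segment z -> modc p.[z] <= K.
Proof.
exists (\sum_(i < size p) modc p`_i * (1 + `|m| + 2 * r) ^+ i) => z zE.
rewrite horner_coef; apply: le_trans (ler_modc_sum _ _ _) _.
apply: ler_sum => i _; rewrite modcM modcX ler_wpM2l ?modc_ge0//.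
by rewrite lerXn2r ?nnegrE ?modc_ge0 ?preim_segment_bound// !addr_ge0 ?mulr_ge0 ?(ltW r0).
Qed.

Lemma pnorm_ge p z : preim_segment z -> modc p.[z] <= pnorm preim_segment p.
Proof.
move=> zE; apply: ub_le_sup; last by exists z.
by have [K hK] := poly_bounded_preim p; exists K => _ [w wE <-]; exact: hK.
Qed.

Lemma pnorm_le p M : (forall z, preim_segment z -> modc p.[z] <= M) ->
  pnorm preim_segment p <= M.
Proof.
move=> h; apply: ge_sup; last by move=> _ [z zE <-]; exact: h.
by have [z zE] := preim_segment_neq0; exists (modc p.[z]); exists z.
Qed.

Hypothesis rm : 2 * r < m.

Lemma cheb_preim_is_chebyshev k : (0 < k)%N ->
  is_chebyshev preim_segment (n * k) (cheb_preim k).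
Proof.
move=> k0; split; [exact: cheb_preim_monic|exact: size_cheb_preim|move=> p mp sp].
apply: contraNT; rewrite -leNgt => le; apply/eqP/cheb_preim_unique => // z zE.
apply: le_trans (pnorm_ge _ zE) (le_trans le _); apply: pnorm_le => w wE.
exact: cheb_preim_le.
Qed.

Lemma one_is_chebyshev : is_chebyshev preim_segment (n * 0) 1.
Proof.
rewrite muln0; split; [exact: monic1|exact: size_poly1|move=> p /monicP mp sp].
have /size_poly1P[c _ pE] : size p == 1%N by rewrite sp.
by move: mp; rewrite pE lead_coefC => ->; rewrite eqxx.
Qed.

End ExtremalPoints.

(** * Transfinite diameter *)

Section Fekete.
Variables (R : realType) (E : set R[i]) (mu kappa : R).
Hypotheses (mu0 : 0 < mu) (kappa1 : 1 <= kappa).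
Hypothesis E0 : E !=set0.
Hypothesis basis : forall j : nat, exists p : {poly R[i]},
  [/\ p \is monic, size p = j.+1 & forall z, E z -> modc p.[z] <= kappa * mu ^+ j].
Hypothesis lower : forall (j : nat) (p : {poly R[i]}), p \is monic ->
  size p = j.+1 -> exists2 z, E z & mu ^+ j <= kappa * modc p.[z].

Let vdm k (z : nat -> R[i]) : R :=
  \prod_(i < k) \prod_(j < k | (i < j)%N) modc (z i - z j).

(** The Vandermonde determinant does not change when the powers are replaced by
    monic polynomials of the same degrees; the Leibniz formula then bounds it
    by their norms. *)
Lemma vandermonde_le k (z : 'I_k -> R[i]) : (forall i, E (z i)) ->
  \prod_(i < k) \prod_(j < k | (i < j)%N) modc (z i - z j)
  <= k`!%:R * \prod_(i < k) (kappa * mu ^+ i).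
Proof.
move=> Ez; pose p (i : nat) := projT1 (cid (basis i)).
have pP i := projT2 (cid (basis i)).
pose V := Vandermonde k (\row_(j < k) z j).
pose A := \matrix_(i < k, l < k) (p i)`_l.
have AV i j : (A *m V) i j = (p i).[z j].
  have [_ sz _] := pP i; rewrite !mxE (horner_coef_wide _ (_ : _ <= k)%N) ?sz//.
  by apply: eq_bigr => l _; rewrite !mxE.
have detA : \det A = 1.
  rewrite det_trig; last first.
    apply/is_trig_mxP => i j ij; rewrite mxE nth_default//.
    by have [_ -> _] := pP i.
  rewrite big1// => i _; rewrite mxE; have [/monicP mo sz _] := pP i.
  by move: mo; rewrite /lead_coef sz.
have -> : \prod_(i < k) \prod_(j < k | (i < j)%N) modc (z i - z j) = modc (\det (A *m V)).
  rewrite det_mulmx detA mul1r det_Vandermonde modc_prod; apply: eq_bigr => i _.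
  by rewrite modc_prod; apply: eq_bigr => j _; rewrite !mxE modc_distC.
rewrite /determinant; apply: le_trans (ler_modc_sum _ _ _) _.
rewrite -card_Sn mulr_natl -sumr_const [leRHS](eq_bigl xpredT); last first.
  by move=> s; rewrite inE.
apply: ler_sum => s _; rewrite modcM modcX modcN modc1 expr1n mul1r modc_prod.
apply: ler_prod => i _; rewrite modc_ge0 AV.
by have [_ _ ->] := pP i.
Qed.

(** Points are added one at a time, each where the monic polynomial that
    vanishes at the previous ones is large. *)
Lemma vandermonde_ge k : exists2 z : nat -> R[i], (forall i, E (z i)) &
  \prod_(i < k) mu ^+ i <= kappa ^+ k * vdm k z.
Proof.
elim: k => [|k [z Ez ih]].
  by have [w Ew] := E0; exists (fun=> w); rewrite /vdm ?big_ord0 ?mulr1.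
pose p := \prod_(i < k) ('X - (z i)%:P).
have [w Ew hw] : exists2 w, E w & mu ^+ k <= kappa * modc p.[w].
  apply: lower; rewrite /p ?monic_prod_XsubC// size_prod_XsubC.
  by rewrite -[index_enum _]filter_predT size_enum_ord.
exists (fun i => if i == k then w else z i); first by move=> i; case: ifP.
have -> : vdm k.+1 (fun i => if i == k then w else z i) = vdm k z * modc p.[w].
  rewrite /vdm big_ord_recr/= [X in _ * X]big1 ?mulr1; last first.
    by move=> j; rewrite ltnNge -ltnS ltn_ord.
  rewrite horner_prod modc_prod -big_split/=; apply: eq_bigr => i _.
  rewrite big_mkcond big_ord_recr/= ltn_ord eqxx ltn_eqF// -big_mkcond/=.
  congr (_ * _); last by rewrite hornerXsubC modc_distC.
  by apply: eq_bigr => j _; rewrite ltn_eqF.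
rewrite big_ord_recr exprSr mulrACA; apply: ler_pM => //.
  by apply: prodr_ge0 => i _; rewrite exprn_ge0// ltW.
by rewrite exprn_ge0// ltW.
Qed.

Let N k : nat := \sum_(i < k) i.

Lemma prod_mu k : \prod_(i < k) mu ^+ i = mu ^+ N k.
Proof. by rewrite /N (big_morph _ (exprD mu) (expr0 mu)). Qed.

Lemma fekete_le k : fekete E k <= k`!%:R * (kappa ^+ k * mu ^+ N k).
Proof.
apply: ge_sup.
  have [w Ew] := E0; eexists; exists (fun=> w) => //.
move=> _ [z /= Ez <-]; apply: le_trans (vandermonde_le Ez) _.
by rewrite big_split/= prodr_const card_ord prod_mu.
Qed.

Lemma fekete_ge k : mu ^+ N k <= kappa ^+ k * fekete E k.
Proof.
have [z Ez] := vandermonde_ge k; rewrite prod_mu => /le_trans; apply.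
rewrite ler_wpM2l ?exprn_ge0 ?(le_trans _ kappa1)//.
apply: ub_le_sup; last by exists (fun i : 'I_k => z i).
by eexists => _ [w /= Ew <-]; exact: vandermonde_le.
Qed.

Lemma fact_le_expn k : (k`! <= k ^ k)%N.
Proof.
elim: k => // k ih; rewrite factS expnS leq_mul2l/=.
by apply: leq_trans ih _; case: k => // k; rewrite leq_exp2r.
Qed.

(** A crude form of ln x / x --> 0 that suffices for the root of k!. *)
Lemma ln_le_2sqrt (x : R) : 0 < x -> ln x <= 2 * Num.sqrt x.
Proof.
move=> x0; have s0 : 0 < Num.sqrt x by rewrite sqrtr_gt0.
have -> : ln x = 2 * ln (Num.sqrt x).
  by rewrite mulr_natl -lnXn// sqr_sqrtr// ltW.
by rewrite ler_wpM2l// ltW// ln_sublinear.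
Qed.

Let NE k : (N k)%:R = k%:R * k.-1%:R / 2 :> R.
Proof.
rewrite /N; elim: k => [|k ih]; first by rewrite big_ord0 !mul0r.
rewrite big_ord_recr natrD ih/=; case: k {ih} => [|k]; first by rewrite /=; ring.
by rewrite /= -!natr1; field.
Qed.

Lemma fekete_log k : (2 <= k)%N ->
  0 < fekete E k /\
  `|2 / (k * k.-1)%:R * ln (fekete E k) - ln mu| <=
     (8 + 4 * ln kappa) / Num.sqrt k%:R.
Proof.
move=> k2; have kap0 : 0 < kappa by apply: lt_le_trans kappa1.
have F0 : 0 < fekete E k.
  rewrite -(@pmulr_rgt0 _ (kappa ^+ k)) ?exprn_gt0//.
  by apply: lt_le_trans (fekete_ge k); rewrite exprn_gt0.
split=> //; have k0 : (0 : R) < k%:R by rewrite ltr0n; apply: leq_trans k2.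
have k10 : (0 : R) < k.-1%:R by rewrite ltr0n; case: (k) k2 => [|[]].
have kk : k%:R <= 2 * k.-1%:R :> R by rewrite -natrM ler_nat; lia.
set s := Num.sqrt k%:R; have s0 : 0 < s by rewrite sqrtr_gt0.
have s1 : 1 <= s by rewrite -[1]sqrtr1 ler_sqrt// ler1n; apply: leq_trans k2.
have ss : s ^+ 2 = k%:R by rewrite sqr_sqrtr// ltW.
have lk : ln k%:R <= 2 * s by exact: ln_le_2sqrt.
have lkap : 0 <= ln kappa by rewrite ln_ge0.
have lk0 : 0 <= ln (k%:R : R) by rewrite ln_ge0// ler1n; apply: leq_trans k2.
have lo : (N k)%:R * ln mu <= k%:R * ln kappa + ln (fekete E k).
  have := fekete_ge k; rewrite -ler_ln ?posrE ?mulr_gt0 ?exprn_gt0//.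
  by rewrite lnM ?posrE ?exprn_gt0// !lnXn// -[ln mu *+ _]mulr_natl -[ln kappa *+ _]mulr_natl.
have up : ln (fekete E k) <= k%:R * ln k%:R + (k%:R * ln kappa + (N k)%:R * ln mu).
  have : fekete E k <= k%:R ^+ k * (kappa ^+ k * mu ^+ N k).
    apply: le_trans (fekete_le k) _.
    rewrite ler_wpM2r ?mulr_ge0 ?exprn_ge0 ?(ltW kap0) ?(ltW mu0)//.
    by rewrite -natrX ler_nat fact_le_expn.
  rewrite -ler_ln ?posrE ?mulr_gt0 ?exprn_gt0//.
  by rewrite !lnM ?posrE ?mulr_gt0 ?exprn_gt0// !lnXn//
    -[ln k%:R *+ _]mulr_natl -[ln mu *+ _]mulr_natl -[ln kappa *+ _]mulr_natl.
have -> : 2 / (k * k.-1)%:R * ln (fekete E k) - ln mu =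
   (2 / k.-1%:R) * ((ln (fekete E k) - (N k)%:R * ln mu) / k%:R).
  by rewrite NE natrM; field; rewrite !gt_eqF.
have h1 : `|(ln (fekete E k) - (N k)%:R * ln mu) / k%:R| <= 2 * s + ln kappa.
  have h2 : k%:R * ln k%:R <= k%:R * (2 * s) by rewrite ler_wpM2l// ltW.
  have h3 : 0 <= k%:R * (2 * s) by rewrite !mulr_ge0// ltW.
  rewrite ler_norml ler_pdivlMr// ler_pdivrMr//; apply/andP; split; lra.
rewrite normrM ger0_norm ?divr_ge0 ?(ltW k10)//.
apply: (@le_trans _ _ ((4 / k%:R) * (2 * s + ln kappa))).
  apply: ler_pM => //; rewrite ?divr_ge0 ?(ltW k10)//.
  by rewrite ler_pdivrMr// mulrAC ler_pdivlMr//; lra.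
have -> : 4 / k%:R * (2 * s + ln kappa) = 4 * (2 + ln kappa / s) / s.
  by rewrite -ss; field; rewrite gt_eqF.
rewrite ler_pM2r ?invr_gt0//.
have : ln kappa / s <= ln kappa by rewrite ler_pdivrMr// ler_peMr.
lra.
Qed.

(** The Vandermonde products over k points lie between kappa^-k mu^N and
    k! kappa^k mu^N with N = k (k - 1) / 2, and the N-th root kills the factors
    that are exponential in k log k. *)
Lemma capacity_eq : capacity E = mu.
Proof.
apply: cvg_lim => //.
pose g k := 2 / (k * k.-1)%:R * ln (fekete E k).
have gl : g k @[k --> \oo] --> ln mu.
  apply/cvgrPdist_le => e e0; have c0 : 0 < 8 + 4 * ln kappa.
    by have := ln_ge0 kappa1; lra.
  near=> k; rewrite distrC /g.
  have k2 : (2 <= k)%N by near: k; exists 2%N.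
  have [_ h] := fekete_log k2; apply: le_trans h _.
  have k0 : (0 : R) < k%:R by rewrite ltr0n; apply: leq_trans k2.
  rewrite ler_pdivrMr ?sqrtr_gt0// -ler_pdivrMl//.
  rewrite -[leLHS]ger0_norm ?mulr_ge0 ?invr_ge0 ?(ltW e0) ?(ltW c0)// -sqrtr_sqr ler_sqrt//.
  by near: k; exact: nbhs_infty_ger.
have -> : mu = expR (ln mu) by rewrite lnK.
have h : expR (g k) @[k --> \oo] --> expR (ln mu).
  apply: (cvg_comp _ _ gl); exact: continuous_expR.
apply: cvg_trans h; apply: near_eq_cvg; near=> k.
have k2 : (2 <= k)%N by near: k; exists 2%N.
have [F0 _] := fekete_log k2.
by rewrite /g /powR gt_eqF.
Unshelve. all: by end_near.
Qed.

End Fekete.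

Section CapacityPreimage.
Variables (R : realType) (m r : R).
Hypotheses (r0 : 0 < r) (rm : 2 * r < m).
Variable n : nat.
Hypothesis n0 : (0 < n)%N.

Let mu := r `^ n%:R^-1.
Let K := 1 + `|m| + 2 * r.
(* K bounds |z| on E, and at most n factors K / mu have to be absorbed. *)
Let kappa := 2 * (1 + K / mu) ^+ n.

Let mu0 : 0 < mu. Proof. exact: powR_gt0. Qed.

Let muX (q : nat) : mu ^+ (n * q) = r ^+ q.
Proof.
suff -> : mu ^+ (n * q) = (mu ^+ n) ^+ q.
  rewrite -[mu ^+ n]powR_mulrn ?(ltW mu0)// -powRrM mulVf ?powRr1 ?(ltW r0)//.
  by rewrite pnatr_eq0 -lt0n.
exact: exprM.
Qed.

Let K1 : 1 <= K.
Proof. by have := normr_ge0 m; have := r0; rewrite /K; lra. Qed.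

Let Kmu0 : 0 < K / mu.
Proof. by rewrite divr_gt0// (lt_le_trans _ K1). Qed.

Let pow_le (i : nat) : (i <= n)%N -> (K / mu) ^+ i <= (1 + K / mu) ^+ n.
Proof.
move=> lt; apply: (@le_trans _ _ ((1 + K / mu) ^+ i)).
  by rewrite lerXn2r ?nnegrE ?addr_ge0 ?(ltW Kmu0)// lerDr.
by rewrite ler_weXn2l// lerDl ltW.
Qed.

(** Powers of z interpolate between the degrees that are multiples of n; the
    loss is bounded because fewer than n factors are used. *)
Lemma preim_segment_basis (j : nat) : exists p : {poly R[i]},
  [/\ p \is monic, size p = j.+1 &
      forall z, preim_segment m r n z -> modc p.[z] <= kappa * mu ^+ j].
Proof.
pose q := (j %/ n)%N; pose s := (j %% n)%N.
have jE : j = (n * q + s)%N by rewrite mulnC -divn_eq.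
have sn : (s <= n)%N by rewrite ltnW// ltn_mod.
have [T [mT sT Tle]] : exists T : {poly R[i]}, [/\ T \is monic,
    size T = (n * q).+1 & forall z, preim_segment m r n z -> modc T.[z] <= 2 * r ^+ q].
  case: (q) => [|q'].
    exists 1; rewrite monic1 size_poly1 muln0; split=> // z _.
    by rewrite hornerC modc1 expr0 mulr1 ler1n.
  exists (cheb_preim m r n q'.+1); rewrite cheb_preim_monic// size_cheb_preim//.
  by split=> // z; exact: cheb_preim_le.
exists (T * 'X^s); split.
- by rewrite monicMl ?monicXn.
- by rewrite size_monicM ?monic_neq0 ?monicXn// sT size_polyXn addnS addSn/= jE.
move=> z zE; rewrite hornerM hornerXn modcM modcX.
have zK := preim_segment_bound r0 n0 zE.
apply: (@le_trans _ _ (2 * r ^+ q * K ^+ s)).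
  by rewrite ler_pM ?exprn_ge0 ?modc_ge0 ?Tle// lerXn2r ?nnegrE ?modc_ge0// (le_trans _ K1).
have -> : 2 * r ^+ q * K ^+ s = 2 * (K / mu) ^+ s * mu ^+ j.
  by rewrite {1}jE exprD muX expr_div_n; field; rewrite expf_neq0// gt_eqF.
by rewrite ler_wpM2r ?exprn_ge0 ?(ltW mu0)// /kappa ler_wpM2l// pow_le.
Qed.

(** Multiplying p by a power of z brings its degree to a multiple of n, where
    the least norm is known. *)
Lemma preim_segment_lower (j : nat) (p : {poly R[i]}) : p \is monic ->
  size p = j.+1 ->
  exists2 z, preim_segment m r n z & mu ^+ j <= kappa * modc p.[z].
Proof.
move=> mp sp; pose q := (j %/ n)%N; pose s := (j %% n)%N.
have sn : (s < n)%N by rewrite ltn_mod.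
have jE : (j + (n - s) = n * q.+1)%N.
  by have := divn_eq j n; rewrite -/q -/s; nia.
pose p' := p * 'X^(n - s).
have sp' : size p' = (n * q.+1).+1.
  by rewrite size_monicM ?monic_neq0 ?monicXn// sp size_polyXn addnS addSn/= jE.
have mp' : p' \is monic by rewrite monicMl ?monicXn.
have [z zE le] := cheb_preim_norm_ge r0 n0 (ltn0Sn q) rm mp' sp'.
exists z => //; have zK := preim_segment_bound r0 n0 zE.
have pz0 := modc_ge0 p.[z].
have h : 2 * mu ^+ j * mu ^+ (n - s) <= modc p.[z] * K ^+ (n - s).
  rewrite -mulrA -exprD jE muX; apply: le_trans le _.
  rewrite hornerM hornerXn modcM modcX ler_wpM2l//.
  by rewrite lerXn2r ?nnegrE ?modc_ge0// (le_trans _ K1).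
have {}h : 2 * mu ^+ j <= modc p.[z] * (K / mu) ^+ (n - s).
  by rewrite expr_div_n mulrA ler_pdivlMr// exprn_gt0.
have : modc p.[z] * (K / mu) ^+ (n - s) <= modc p.[z] * (1 + K / mu) ^+ n.
  by rewrite ler_wpM2l// pow_le// leq_subr.
have : 0 <= mu ^+ j by rewrite exprn_ge0// ltW.
rewrite /kappa; have : 0 <= modc p.[z] * (1 + K / mu) ^+ n.
  by rewrite mulr_ge0// exprn_ge0// addr_ge0// ltW.
lra.
Qed.

Lemma capacity_preim_segment : capacity (preim_segment m r n) = mu.
Proof.
apply: (@capacity_eq _ _ _ kappa) => //.
- have : 1 <= (1 + K / mu) ^+ n by rewrite exprn_ege1// lerDl ltW.
  by rewrite /kappa; lra.
- exact: preim_segment_neq0.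
- exact: preim_segment_basis.
- exact: preim_segment_lower.
Qed.

End CapacityPreimage.

(** * Complex differentiation by difference quotients *)

#[local] Hint Extern 9 (Filter _) =>
  exact: (@nbhs_filter (_ : numFieldType)^o) : typeclass_instances.
#[local] Hint Extern 9 (ProperFilter _) =>
  exact: (@nbhs_pfilter (_ : numFieldType)^o) : typeclass_instances.

Section ComplexTopology.
Variable R : realType.

Let cvg_epsdelta (K : numFieldType) (V : normedModType K) (f : V -> R) (z : V) (l : R) :
  (forall e : R, 0 < e -> exists2 d : K, 0 < d & forall x, `|z - x| < d -> `|l - f x| < e) ->
  f x @[x --> z] --> l.
Proof.
move=> h; apply/cvgrPdist_lt => e /h[d d0 hd]; near=> x; apply: hd.
by near: x; apply: (@cvgr_dist_lt _ V) d0; exact: cvg_id.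
Unshelve. all: by end_near.
Qed.

Let continuous_lip1 (f : R[i] -> R) : (forall z x, `|f z - f x| <= modc (z - x)) ->
  continuous (f : R[i]^o -> R).
Proof.
move=> h z; apply: (@cvg_epsdelta R[i] R[i]^o) => e e0; exists e%:C; first by rewrite ltcR.
by move=> x; rewrite normE ltcR; apply: le_lt_trans.
Qed.

Lemma continuous_Re : continuous (@complex.Re R : R[i]^o -> R).
Proof. by apply: continuous_lip1 => z x; rewrite -ReN -ReD Re_le_modc. Qed.

Lemma continuous_Im : continuous (@complex.Im R : R[i]^o -> R).
Proof. by apply: continuous_lip1 => z x; rewrite -ImN -ImD Im_le_modc. Qed.

Lemma continuous_modc : continuous (@modc R : R[i]^o -> R).
Proof.
apply: continuous_lip1 => z x.
by rewrite ler_norml lerB_modc andbT lerNl opprB modc_distC lerB_modc.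
Qed.

Let cvg_Kepsdelta (K : numFieldType) (f : R -> K) (t : R) (l : K) :
  (forall e : K, 0 < e -> exists2 d : R, 0 < d & forall x, `|t - x| < d -> `|l - f x| < e) ->
  f x @[x --> t] --> l.
Proof.
move=> h; apply/cvgrPdist_lt => e /h[d d0 hd]; near=> x; apply: hd.
by near: x; apply: (@cvgr_dist_lt _ R^o) d0; exact: cvg_id.
Unshelve. all: by end_near.
Qed.

Lemma continuous_realC : continuous (fun t : R => t%:C : R[i]^o).
Proof.
move=> t; apply: cvg_Kepsdelta => e e0.
have eE : e = (complex.Re e)%:C by rewrite RRe_real// gtr0_real.
exists (complex.Re e) => [|x h]; first by rewrite eE ltcR in e0.
by rewrite -realCB normE modcR eE ltcR.
Qed.

Lemma continuous_expi : continuous (fun t : R => expi t : R[i]^o).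
Proof.
have -> : (fun t : R => expi t : R[i]^o) =
    (fun t => (cos t)%:C + 'i%C * (sin t)%:C : R[i]^o).
  by apply/funext => x; rewrite [LHS]complexE.
move=> t; apply: cvgD.
  apply: (@cvg_comp _ _ _ cos (fun t : R => t%:C : R[i]^o) _ (nbhs (cos t))).
    exact: continuous_cos.
  exact: continuous_realC.
apply: cvgM; first exact: cvg_cst.
apply: (@cvg_comp _ _ _ sin (fun t : R => t%:C : R[i]^o) _ (nbhs (sin t))).
  exact: continuous_sin.
exact: continuous_realC.
Qed.

Lemma nbhs_modc (z : R[i]) (P : R[i] -> Prop) (d : R) : 0 < d ->
  (forall x, modc (z - x) < d -> P x) -> \forall x \near (z : R[i]^o), P x.
Proof.
move=> d0 h; apply/(@nbhs_ballP R[i] R[i]^o); exists d%:C => /=; first by rewrite ltcR.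
by move=> x; rewrite -ball_normE/= normE ltcR; exact: h.
Qed.

End ComplexTopology.

Lemma lipschitz_at_continuous (K : numFieldType) (V W : normedModType K)
    (f : V -> W) (z : V) (k : K) : 0 < k ->
  (\forall x \near z, `|f z - f x| <= k * `|z - x|) -> {for z, continuous f}.
Proof.
move=> k0 h; apply/cvgrPdist_lt => e e0; near=> x.
apply: (@le_lt_trans _ _ (k * `|z - x|)); first by near: x.
rewrite -ltr_pdivlMl//; near: x.
by apply: cvgr_dist_lt; [exact: cvg_id|rewrite mulr_gt0// invr_gt0].
Unshelve. all: by end_near.
Qed.

Section ComplexDerivative.
Variable K : numFieldType.
Local Notation CC := (K^o).
Implicit Types (z d e : CC) (f g : CC -> CC).

(** Caratheodory's form of complex differentiability: the difference quotient
    extends continuously to the point. It composes without limits. *)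
Definition cderivable f z d : Prop := exists q : CC -> CC,
  [/\ \forall x \near z, f x - f z = (x - z) * q x, {for z, continuous q} & q z = d].

Lemma cderivableP f z d : cderivable f z d -> derivable f z 1 /\ 'D_1 f z = d.
Proof.
move=> [q [nq cq qz]].
have cshift : (fun h : CC => h + z) @ (0 : CC)^' --> z.
  rewrite -[X in _ --> X]add0r; apply: cvgD; last exact: cvg_cst.
  exact: (@cvg_within _ (nbhs (0 : CC))).
have h : (fun h : CC => h^-1 *: (f (h *: (1 : CC) + z) - f z)) @ 0^' --> d.
  have cq' : (fun h : CC => q (h + z)) @ 0^' --> d.
    by rewrite -qz; exact: cvg_comp cshift cq.
  apply: cvg_trans cq'; apply: near_eq_cvg; near=> h.
  have h0 : h != 0 by near: h; exact: nbhs_dnbhs_neq.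
  have -> : h *: (1 : CC) + z = h + z by rewrite /GRing.scale/= mulr1.
  rewrite (_ : f (h + z) - f z = h * q (h + z)) /GRing.scale/= ?mulrA ?mulVf ?mul1r//.
  rewrite -[X in X * _](addrK z); near: h.
  exact: cshift nq.
split; first by apply/cvg_ex; exists d.
exact: cvg_lim h.
Unshelve. all: by end_near.
Qed.

Lemma cderivable_continuous f z d : cderivable f z d -> {for z, continuous f}.
Proof.
move=> [q [nq cq _]].
have h : (fun x : CC => f z + (x - z) * q x) x @[x --> z] --> f z + (z - z) * q z.
  apply: cvgD; first exact: cvg_cst.
  by apply: cvgM => //; apply: cvgB; [exact: cvg_id|exact: cvg_cst].
rewrite subrr mul0r addr0 in h.
apply: cvg_trans h; apply: near_eq_cvg; near=> x.
have -> : (x - z) * q x = f x - f z by apply/esym; near: x.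
by rewrite addrC subrK.
Unshelve. all: by end_near.
Qed.

Lemma cderivable_cst (a : CC) z : cderivable (fun=> a) z 0.
Proof.
exists (fun=> 0); split=> //; last exact: cvg_cst.
by near=> x; rewrite subrr mulr0.
Unshelve. all: by end_near.
Qed.

Lemma cderivable_id z : cderivable id z 1.
Proof.
exists (fun=> 1); split=> //; last exact: cvg_cst.
by near=> x; rewrite mulr1.
Unshelve. all: by end_near.
Qed.

Lemma cderivableD f g z d e : cderivable f z d -> cderivable g z e ->
  cderivable (fun x => f x + g x) z (d + e).
Proof.
move=> [q [nq cq <-]] [p [np cp <-]]; exists (fun x => q x + p x).
split=> //; last exact: cvgD.
near=> x; rewrite mulrDr opprD addrACA; congr (_ + _); by near: x.
Unshelve. all: by end_near.
Qed.

Lemma cderivableM f g z d e : cderivable f z d -> cderivable g z e ->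
  cderivable (fun x => f x * g x) z (d * g z + f z * e).
Proof.
move=> fd gd; have cg := cderivable_continuous gd.
case: fd gd => [q [nq cq <-]] [p [np cp <-]].
exists (fun x => q x * g x + f z * p x); split=> //; last first.
  by apply: cvgD; apply: cvgM => //; exact: cvg_cst.
near=> x.
have -> : f x * g x - f z * g z = (f x - f z) * g x + f z * (g x - g z) by ring.
have -> : f x - f z = (x - z) * q x by near: x.
have -> : g x - g z = (x - z) * p x by near: x.
by ring.
Unshelve. all: by end_near.
Qed.

Lemma cderivableX f z d k : cderivable f z d ->
  exists e, cderivable (fun x => f x ^+ k) z e.
Proof.
move=> fd; elim: k => [|k [e ih]].
  by exists 0; exact: cderivable_cst.
exists (d * f z ^+ k + f z * e).
have -> : (fun x => f x ^+ k.+1) = (fun x => f x * f x ^+ k).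
  by apply/funext => x; rewrite exprS.
exact: cderivableM.
Qed.

Lemma cderivableV f z d : f z != 0 -> cderivable f z d ->
  cderivable (fun x => (f x)^-1) z (- d / (f z * f z)).
Proof.
move=> fz0 fd; have cf := cderivable_continuous fd.
case: fd => [q [nq cq <-]]; exists (fun x => - q x / (f x * f z)); split=> //.
  near=> x.
  have fx0 : f x != 0 by near: x; exact: (cvgr_neq0 _ cf fz0).
  have -> : (x - z) * (- q x / (f x * f z)) = - ((x - z) * q x) / (f x * f z) by ring.
  have <- : f x - f z = (x - z) * q x by near: x.
  by field; rewrite fz0 fx0.
apply: cvgM; first exact: cvgN.
by apply: cvgV; [rewrite mulf_neq0|apply: cvgM => //; exact: cvg_cst].
Unshelve. all: by end_near.
Qed.

Lemma cderivable_comp f g z d e : cderivable g z e -> cderivable f (g z) d ->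
  cderivable (fun x => f (g x)) z (d * e).
Proof.
move=> gd; have cg := cderivable_continuous gd.
case: gd => [q [nq cq <-]] [p [np cp <-]]; exists (fun x => p (g x) * q x); split=> //.
  near=> x.
  have -> : f (g x) - f (g z) = (g x - g z) * p (g x) by near: x; exact: cg np.
  have -> : g x - g z = (x - z) * q x by near: x.
  by ring.
by apply: cvgM => //; exact: cvg_comp cg cp.
Unshelve. all: by end_near.
Qed.

Lemma continuous_sum (I : Type) (s : seq I) (F : I -> CC -> CC) z :
  (forall i, {for z, continuous (F i)}) ->
  {for z, continuous (fun x => \sum_(i <- s) F i x)}.
Proof.
move=> cF; elim: s => [|i s ih].
  have -> : (fun x => \sum_(i <- [::]) F i x) = (fun=> 0).
    by apply/funext => x; rewrite big_nil.
  exact: cvg_cst.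
have -> : (fun x => \sum_(j <- i :: s) F j x) = (fun x => F i x + \sum_(j <- s) F j x).
  by apply/funext => x; rewrite big_cons.
by apply: cvgD => //; exact: cF.
Qed.

Lemma near_cderivable f g z d : (\forall x \near z, f x = g x) ->
  cderivable f z d -> cderivable g z d.
Proof.
move=> fg [q [nq cq qz]]; exists q; split=> //.
have fz : f z = g z by exact: nbhs_singleton fg.
by near=> x; rewrite -fz -(near fg x)//; near: x.
Unshelve. all: by end_near.
Qed.

Lemma cderivable_unique f z d e : cderivable f z d -> cderivable f z e -> d = e.
Proof. by move=> /cderivableP[_ <-] /cderivableP[_ <-]. Qed.

End ComplexDerivative.

(** * The principal n-th root on the right half-plane *)

Section PrincipalRoot.
Variables (R : realType) (n : nat).
Hypothesis n0 : (0 < n)%N.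
Implicit Types (s : R[i]).

Definition parg s : R := atan (complex.Im s / complex.Re s).

Definition proot s : R[i] :=
  (modc s `^ n%:R^-1)%:C * expi (parg s / n%:R).

Let nR0 : (0 : R) < n%:R. Proof. by rewrite ltr0n. Qed.

Lemma parg_polar s : 0 < complex.Re s -> s = (modc s)%:C * expi (parg s).
Proof.
move=> s0; have c0 : 0 < cos (parg s).
  by apply: cos_gt0_pihalf; rewrite atan_gtNpi2 atan_ltpi2.
have sE : sin (parg s) = complex.Im s / complex.Re s * cos (parg s).
  by rewrite -[_ / _]atanK /tan divfK// gt_eqF.
pose rho := complex.Re s / cos (parg s).
have e : s = rho%:C * expi (parg s).
  rewrite /expi sE [LHS](_ : _ = complex.Re s +i* complex.Im s); last by case: (s).
  by simpc; rewrite /rho; congr (_ +i* _); field; rewrite ?gt_eqF.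
by rewrite {1}e {2}e modcM modc_expi mulr1 modcR_ge0// divr_ge0 ?ltW.
Qed.

Lemma proot_expn s : 0 < complex.Re s -> proot s ^+ n = s.
Proof.
move=> s0; rewrite {2}(parg_polar s0) /proot exprMn -realCX -expi_sum.
rewrite -powR_mulrn ?powR_ge0// -powRrM mulVf ?gt_eqF// powRr1 ?modc_ge0//.
by rewrite [n%:R * _]mulrC divfK// gt_eqF.
Qed.

Lemma proot_neq0 s : 0 < complex.Re s -> proot s != 0.
Proof.
move=> s0; apply: contraTneq (s0) => p0; rewrite -leNgt.
by rewrite -(proot_expn s0) p0 expr0n eqn0Ngt n0.
Qed.

(** All powers of proot s below the n-th lie in the closed right half-plane,
    so that the cofactor of proot s - 1 in s - 1 is at least 1. *)
Lemma proot_sub1 s : 0 < complex.Re s -> modc (proot s - 1) <= modc (s - 1).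
Proof.
move=> s0; rewrite -{2}(proot_expn s0) subrX1 modcM ler_peMr ?modc_ge0//.
apply: le_trans (Re_le_modc _); apply: le_trans (ler_norm _).
rewrite Re_sum (bigD1 (Ordinal n0))//= lerDl; apply: sumr_ge0 => i _.
rewrite /proot exprMn -realCX -expi_sum Re_scale mulr_ge0 ?exprn_ge0 ?powR_ge0//=.
have t1 := atan_gtNpi2 (complex.Im s / complex.Re s).
have t2 := atan_ltpi2 (complex.Im s / complex.Re s).
rewrite -/(parg s) in t1 t2; have pi0 := pi_gt0 R.
pose x : R := i%:R / n%:R.
have x01 : 0 <= x <= 1.
  by rewrite divr_ge0//= ler_pdivrMr ?ltr0n// mul1r ler_nat ltnW.
have -> : i%:R * (parg s / n%:R) = x * parg s by rewrite /x mulrAC mulrA.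
apply: cos_ge0_pihalf; move: x01 => /andP[x0 x1].
have h1 : 0 <= (1 - x) * (pi / 2) by rewrite mulr_ge0 ?subr_ge0// divr_ge0// ltW.
have h2 : 0 <= x * (pi / 2 - parg s) by rewrite mulr_ge0// subr_ge0 ltW.
have h3 : 0 <= x * (pi / 2 + parg s) by rewrite mulr_ge0//; lra.
by apply/andP; split; lra.
Qed.

Lemma continuous_parg s : 0 < complex.Re s ->
  {for s, continuous (parg : R[i]^o -> R)}.
Proof.
move=> s0; apply: (@cvg_comp _ _ _ (fun x : R[i]^o => complex.Im x / complex.Re x)
  atan _ (nbhs (complex.Im s / complex.Re s))); last exact: continuous_atan.
apply: cvgM; first exact: continuous_Im.
by apply: cvgV; [rewrite gt_eqF|exact: continuous_Re].
Qed.

Lemma continuous_proot s : 0 < complex.Re s ->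
  {for s, continuous (proot : R[i]^o -> R[i]^o)}.
Proof.
move=> s0; have ms0 : 0 < modc s.
  by apply: lt_le_trans s0 (le_trans (ler_norm _) (Re_le_modc _)).
apply: cvgM.
  apply: (@cvg_comp _ _ _ (fun x : R[i]^o => modc x `^ n%:R^-1) (fun t : R => t%:C : R[i]^o)
    _ (nbhs (modc s `^ n%:R^-1))); last exact: continuous_realC.
  apply: (@cvg_comp _ _ _ (@modc R : R[i]^o -> R) (@powR R ^~ n%:R^-1)
    _ (nbhs (modc s))); first exact: continuous_modc.
  have : {for modc s, continuous (@powR R ^~ n%:R^-1)}; last exact.
  apply: differentiable_continuous; rewrite -derivable1_diffP.
  by apply: derivable_powR; rewrite in_itv/= ms0.
apply: (@cvg_comp _ _ _ (fun x : R[i]^o => parg x / n%:R) (fun t : R => expi t : R[i]^o)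
    _ (nbhs (parg s / n%:R))); last exact: continuous_expi.
by apply: cvgM; [exact: continuous_parg|exact: cvg_cst].
Qed.

Lemma near_Re_gt0 s : 0 < complex.Re s -> \forall x \near (s : R[i]^o), 0 < complex.Re x.
Proof.
move=> s0; apply: (nbhs_modc s0) => x h.
have : complex.Re s - complex.Re x <= modc (s - x).
  by rewrite -ReN -ReD; apply: le_trans (ler_norm _) (Re_le_modc _).
lra.
Qed.

(** The difference quotient of the root is the inverse of the cofactor of
    x - y in x^n - y^n, which is continuous because the root is. *)
Lemma cderivable_proot s : 0 < complex.Re s ->
  exists d, cderivable (proot : R[i]^o -> R[i]^o) s d.
Proof.
move=> s0; pose q (x : R[i]^o) : R[i]^o :=
  (\sum_(i < n) proot x ^+ (n.-1 - i) * proot s ^+ i)^-1.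
exists (q s), q; split=> //.
  near=> x; have x0 : 0 < complex.Re x by near: x; exact: near_Re_gt0.
  have [->|xs] := eqVneq x s; first by rewrite !subrr mul0r.
  have e : x - s = (proot x - proot s) * (\sum_(i < n) proot x ^+ (n.-1 - i) * proot s ^+ i).
    by rewrite -subrXX !proot_expn.
  have : x - s != 0 by rewrite subr_eq0.
  by rewrite /q {1 2}e mulf_eq0 => /norP[_ h]; rewrite mulfK.
apply: cvgV.
  under eq_bigr => i _.
    rewrite -exprD subnK; last by rewrite -ltnS prednK.
    over.
  rewrite sumr_const card_ord -mulr_natl mulf_neq0 ?expf_neq0 ?proot_neq0//.
  by rewrite pnatr_eq0 -lt0n.
apply: continuous_sum => i; apply: cvgM; last exact: cvg_cst.
apply: (@cvg_comp _ _ _ (proot : R[i]^o -> R[i]^o) (fun y : R[i]^o => y ^+ (n.-1 - i))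
   _ (nbhs (proot s : R[i]^o))); first exact: continuous_proot.
have [e] := cderivableX (n.-1 - i) (cderivable_id (proot s : R[i]^o)).
exact: cderivable_continuous.
Unshelve. all: by end_near.
Qed.

End PrincipalRoot.

(** * Differentiability of the inverse Joukowski map *)

Section JoukowskiInverse.
Variables (R : realType) (m r : R).
Hypothesis r0 : 0 < r.
Local Notation J := (jouk_inv m r).
Implicit Types (x z : R[i]).

(** The complement of the segment is described by a strict inequality between
    continuous functions, hence it is open. *)
Lemma focal_sum_Nsegment z : ~ segment m r z -> 4 * r < focal_sum m r z.
Proof.
move=> /(jouk_invP r0)[h <-]; rewrite focal_sum_jouk ?(neq0_gtr r0)//.
have -> : 4 * r = 2 * (r + r ^+ 2 / r) by field; rewrite gt_eqF.
by rewrite ltr_pM2l// focal_axis_lt.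
Qed.

Lemma near_Nsegment z : ~ segment m r z ->
  \forall x \near (z : R[i]^o), ~ segment m r x.
Proof.
move=> /focal_sum_Nsegment h.
have d0 : 0 < (focal_sum m r z - 4 * r) / 2 by rewrite divr_gt0// subr_gt0.
apply: (nbhs_modc d0) => x hx /(focal_sum_segment r0) e.
have := focal_sum_lip m r z x; rewrite e.
lra.
Qed.

Let jouk_invB z x : ~ segment m r z -> ~ segment m r x ->
  z - x = (J z - J x) * (1 - (r ^+ 2)%:C / (J z * J x)).
Proof.
move=> /(jouk_invP r0)[hz ez] /(jouk_invP r0)[hx ex].
by rewrite -(joukB m) ?ez ?ex ?(neq0_gtr r0).
Qed.

Let cofactor_neq0 z x : ~ segment m r z -> ~ segment m r x ->
  1 - (r ^+ 2)%:C / (J z * J x) != 0.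
Proof.
move=> /(jouk_invP r0)[hz _] /(jouk_invP r0)[hx _].
have : modc ((r ^+ 2)%:C / (J z * J x)) < 1.
  rewrite modc_div modcM modcR ger0_norm ?sqr_ge0// ltr_pdivrMr ?mul1r.
    by rewrite expr2 ltr_pM // ltW.
  by rewrite mulr_gt0// (lt_trans r0).
by move=> h; apply: contraTneq h => /subr0_eq <-; rewrite modc1 ltxx.
Qed.

Lemma continuous_jouk_inv z : ~ segment m r z ->
  {for z, continuous (J : R[i]^o -> R[i]^o)}.
Proof.
move=> Nz; have [hz _] := jouk_invP r0 Nz.
have Jz0 : 0 < modc (J z) by exact: lt_trans hz.
have d0 : 0 < 1 - r / modc (J z) by rewrite subr_gt0 ltr_pdivrMr// mul1r.
apply: (@lipschitz_at_continuous R[i] R[i]^o R[i]^o _ _ ((1 - r / modc (J z))^-1)%:C).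
  by rewrite ltcR invr_gt0.
apply: filterS (near_Nsegment Nz) => x Nx; have [hx _] := jouk_invP r0 Nx.
have Jx0 : 0 < modc (J x) by exact: lt_trans hx.
rewrite !normE -realCM lecR ler_pdivlMl// (jouk_invB Nz Nx) modcM mulrC.
rewrite ler_wpM2l ?modc_ge0//.
apply: le_trans (lerB_modc _ _); rewrite modc1 lerB//.
rewrite modc_div modcM modcR ger0_norm ?sqr_ge0// ler_pdivrMr ?mulr_gt0//.
by rewrite mulrA divfK ?gt_eqF// expr2 ler_wpM2l// ltW.
Qed.

Lemma cderivable_jouk_inv z : ~ segment m r z ->
  exists d, cderivable (J : R[i]^o -> R[i]^o) z d.
Proof.
move=> Nz; pose q (x : R[i]^o) : R[i]^o := (1 - (r ^+ 2)%:C / (J x * J z))^-1.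
exists (q z), q; split=> //.
  by apply: filterS (near_Nsegment Nz) => x Nx; rewrite (jouk_invB Nx Nz) /q mulfK// cofactor_neq0.
have [hz _] := jouk_invP r0 Nz.
apply: cvgV; first exact: cofactor_neq0.
apply: cvgB; first exact: cvg_cst.
apply: cvgM; first exact: cvg_cst.
apply: cvgV; first by rewrite mulf_neq0// (neq0_gtr r0).
by apply: cvgM; [exact: continuous_jouk_inv|exact: cvg_cst].
Qed.

End JoukowskiInverse.

Section RadialMap.
Variables (R : realType) (m r p0 p1 a : R).
Hypotheses (p1_gt0 : 0 < p1) (p1r : p1 < r) (pM : p0 * p1 = r ^+ 2)
  (pD : p0 + p1 = m).
Variable n : nat.
Hypotheses (n2 : (2 <= n)%N) (a0 : 0 < a) (aX : a ^+ n = p0).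
Local Notation J := (jouk_inv m r).
Local Notation E := (preim_segment m r n).
Implicit Types (u w z : R[i]).

Let r0 : 0 < r. Proof. exact: lt_trans p1r. Qed.
Let n0 : (0 < n)%N. Proof. exact: leq_trans n2. Qed.
Let rm : 2 * r < m.
Proof.
have p00 : 0 < p0 by rewrite -aX exprn_gt0.
have : r < p0.
  rewrite ltNge; apply/negP => h; suff : p0 * p1 < r ^+ 2 by rewrite pM ltxx.
  by rewrite expr2 (@le_lt_trans _ _ (r * p1)) ?ler_pM2r ?ltr_pM2l.
have : 0 < (r - p1) ^+ 2 by rewrite exprn_gt0// subr_gt0.
have : p0 + p1 - 2 * r = (r - p1) ^+ 2 / p1.
  apply: (@mulIf _ p1); first by rewrite gt_eqF.
  by rewrite divfK ?gt_eqF//; move: pM; nra.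
move=> e h _; rewrite -pD -subr_gt0 e divr_gt0//.
Qed.

(** The zeros -p0 and -p1 of the Joukowski map correspond to the origin; -p0 is
    the one outside the circle |u| = r. *)
Lemma jouk_factor u : u != 0 -> jouk m r u = (u + p0%:C) * (u + p1%:C) / u.
Proof. by move=> u0; rewrite /jouk -pD -pM realCD realCM; field. Qed.

Let half u : r < modc u -> 0 < complex.Re (1 + p1%:C / u).
Proof.
move=> hu; have u0 : 0 < modc u by exact: lt_trans hu.
have h : modc (p1%:C / u) < 1.
  by rewrite modc_div modcR ger0_norm ?(ltW p1_gt0)// ltr_pdivrMr// mul1r (lt_trans p1r).
have := Re_le_modc (p1%:C / u); rewrite ReD/= ler_norml => /andP[h1 _]; lra.
Qed.

Let half_neq0 u : r < modc u -> u + p1%:C != 0.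
Proof.
move=> hu; rewrite addr_eq0; apply: contraTneq hu => ->.
by rewrite modcN modcR ger0_norm ?(ltW p1_gt0)// -leNgt ltW.
Qed.

(** The n-th root of J (z^n) + p0 that behaves like z at infinity. By
    jouk_factor, z^n / (J (z^n) + p0) = 1 + p1 / J (z^n), which lies in the right
    half-plane as p1 < r < |J|; so the branch is the principal one, and no
    singularity arises at z = 0. *)
Definition lemn_map z : R[i] := z / proot n (1 + p1%:C / J (z ^+ n)).

Definition lemn_map_inv w : R[i] := w * proot n (1 + p1%:C / (w ^+ n - p0%:C)).

Lemma lemn_map_expn z : ~ E z -> lemn_map z ^+ n = J (z ^+ n) + p0%:C.
Proof.
move=> /(jouk_invP r0)[hu e]; have u0 := neq0_gtr r0 hu.
rewrite expr_div_n proot_expn ?half// -{1}e jouk_factor//.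
by field; rewrite u0 half_neq0.
Qed.

Lemma lemn_map_inv_expn w : r < modc (w ^+ n - p0%:C) ->
  lemn_map_inv w ^+ n = jouk m r (w ^+ n - p0%:C).
Proof.
move=> hu; have u0 := neq0_gtr r0 hu.
rewrite exprMn proot_expn ?half// jouk_factor// subrK.
by field; rewrite u0.
Qed.

Lemma lemn_mapK z : ~ E z -> lemn_map_inv (lemn_map z) = z.
Proof.
move=> Ez; rewrite /lemn_map_inv lemn_map_expn// addrK divfK//.
by rewrite proot_neq0// half//; have [] := jouk_invP r0 Ez.
Qed.

Lemma lemn_map_invK w : r < modc (w ^+ n - p0%:C) ->
  ~ E (lemn_map_inv w) /\ lemn_map (lemn_map_inv w) = w.
Proof.
move=> hu; have e := lemn_map_inv_expn hu; split.
  by rewrite /preim_segment/= e; exact: jouk_Nseg.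
by rewrite /lemn_map e joukK// mulfK// proot_neq0// half.
Qed.

Let cderivable_proot_arg (g : R[i] -> R[i]) z d : r < modc (g z) ->
  cderivable (g : R[i]^o -> R[i]^o) z d ->
  exists e, cderivable (fun x : R[i]^o => proot n (1 + p1%:C / g x) : R[i]^o) z e.
Proof.
move=> hg gd; have g0 := neq0_gtr r0 hg.
have [e he] := cderivable_proot n0 (half hg).
eexists; apply: (@cderivable_comp _ (proot n : R[i]^o -> R[i]^o)
  (fun x : R[i]^o => 1 + p1%:C / g x)); last exact: he.
apply: cderivableD; first exact: cderivable_cst.
apply: cderivableM; first exact: cderivable_cst.
exact: (@cderivableV _ (g : R[i]^o -> R[i]^o) _ _ g0 gd).
Qed.

Lemma cderivable_lemn_map z : ~ E z ->
  exists d, cderivable (lemn_map : R[i]^o -> R[i]^o) z d.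
Proof.
move=> Ez; have [hu _] := jouk_invP r0 Ez.
have [e he] := cderivable_jouk_inv r0 Ez.
have [f hf] := cderivableX n (cderivable_id (z : R[i]^o)).
have [g hg] := @cderivable_proot_arg (fun x => J (x ^+ n)) z _ hu (cderivable_comp hf he).
eexists; apply: cderivableM; first exact: cderivable_id.
by apply: cderivableV hg; rewrite proot_neq0// half.
Qed.

Lemma cderivable_lemn_map_inv w : r < modc (w ^+ n - p0%:C) ->
  exists d, cderivable (lemn_map_inv : R[i]^o -> R[i]^o) w d.
Proof.
move=> hu; have [f hf] := cderivableX n (cderivable_id (w : R[i]^o)).
have hf' := cderivableD hf (cderivable_cst (- p0%:C) (w : R[i]^o)).
have [g hg] := @cderivable_proot_arg (fun x => x ^+ n - p0%:C) w _ hu hf'.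
by eexists; apply: cderivableM; [exact: cderivable_id|exact: hg].
Qed.

Lemma near_NE z : ~ E z -> \forall x \near (z : R[i]^o), ~ E x.
Proof.
move=> Ez; have [f hf] := cderivableX n (cderivable_id (z : R[i]^o)).
exact: (cderivable_continuous hf (near_Nsegment r0 Ez)).
Qed.

(** The derivative does not vanish because the inverse map is differentiable
    too. *)
Lemma lemn_map_conformal : conformal (~` E) lemn_map.
Proof.
move=> z Ez; have [d hd] := cderivable_lemn_map Ez.
have hw : r < modc (lemn_map z ^+ n - p0%:C).
  by rewrite lemn_map_expn// addrK; have [] := jouk_invP r0 Ez.
have [e he] := cderivable_lemn_map_inv hw.
have [? ->] := cderivableP hd; split=> //.
have hid : cderivable (id : R[i]^o -> R[i]^o) z (e * d).
  apply: near_cderivable (cderivable_comp hd he).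
  by apply: filterS (near_NE Ez) => x Ex; exact: lemn_mapK.
have := cderivable_unique hid (cderivable_id _) => ed.
by apply/eqP => d0; move/eqP: ed; rewrite d0 mulr0 eq_sym oner_eq0.
Qed.

Lemma radial_foci_inj : injective (fun l : 'I_n => a%:C * omega R n ^+ l).
Proof.
move=> l l' /mulfI; rewrite realC_eq0 gt_eqF// => /(_ isT)/eqP.
rewrite (eq_prim_root_expr (omega_prim R n0)) !modn_small// => /eqP.
exact: ord_inj.
Qed.

Lemma radial_expo_gt0 (l : 'I_n) : 0 < (n%:R : R)^-1.
Proof. by rewrite invr_gt0 ltr0n. Qed.

Lemma radial_expo_sum : \sum_(l < n) (n%:R : R)^-1 = 1.
Proof. by rewrite sumr_const card_ord -[LHS]mulr_natr mulVf// pnatr_eq0 -lt0n. Qed.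

Lemma radial_mu_gt0 : 0 < r `^ n%:R^-1.
Proof. exact: powR_gt0. Qed.

Definition radial_lemn : lemniscatic R n :=
  Lemniscatic radial_foci_inj radial_expo_gt0 radial_expo_sum radial_mu_gt0.

Lemma absU_radial w : absU radial_lemn w = modc (w ^+ n - p0%:C) `^ n%:R^-1.
Proof.
rewrite /absU /= -aX realCX -(prod_sub_omega _ _ n0) modc_prod.
suff [] : \prod_(l < n) modc (w - a%:C * omega R n ^+ l) `^ n%:R^-1 =
  (\prod_(l < n) modc (w - a%:C * omega R n ^+ l)) `^ n%:R^-1 /\
  0 <= \prod_(l < n) modc (w - a%:C * omega R n ^+ l) by [].
elim/big_rec2: _ => [|l y x _ [-> y0]]; first by rewrite powR1.
by rewrite powRM ?modc_ge0// mulr_ge0 ?modc_ge0.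
Qed.

Lemma lemn_dom_radial w : lemn_dom radial_lemn w <-> r < modc (w ^+ n - p0%:C).
Proof.
rewrite /lemn_dom/= absU_radial; have n1 : 0 < (n%:R : R)^-1 by rewrite invr_gt0 ltr0n.
split=> [h|h]; last by rewrite gt0_ltr_powR// nnegrE ?modc_ge0 ?ltW.
rewrite ltNge; apply: contraTN h => h; rewrite -leNgt.
by rewrite ge0_ler_powR// ?nnegrE ?modc_ge0 ?ltW.
Qed.

Lemma lemn_map_bij : set_bij (~` E) (lemn_dom radial_lemn) lemn_map.
Proof.
split.
- move=> z Ez; apply/lemn_dom_radial.
  by rewrite lemn_map_expn// addrK; have [] := jouk_invP r0 Ez.
- move=> z z' /set_mem Ez /set_mem Ez' e.
  by rewrite -(lemn_mapK Ez) e lemn_mapK.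
- move=> w /lemn_dom_radial/lemn_map_invK[h1 h2].
  by exists (lemn_map_inv w).
Qed.

(** lemn_map z - z is about z p1 / J (z^n), and |J (z^n)| grows at least like
    |z|^2 as n >= 2. *)
Lemma lemn_map_infty : exists M rho : R, 0 < rho /\
  forall z, rho < modc z -> modc (lemn_map z - z) <= M / modc z.
Proof.
(* Beyond this radius |z|^2 / 4 <= |J (z^n)| and p1 <= |J (z^n)| / 2. *)
exists (8 * p1), (4 * (1 + m + 2 * r)).
have m0 : 0 < m by move: rm r0; lra.
split=> [|z hz]; first by move: r0; lra.
have z1 : 1 <= modc z by move: r0; lra.
have z0 : 0 < modc z by exact: lt_le_trans z1.
have zz : modc z ^+ 2 <= modc z ^+ n by rewrite ler_weXn2l.
have Ez : ~ E z.
  move=> /(preim_segment_bound r0 n0); rewrite ger0_norm ?(ltW m0)//.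
  by move: r0; lra.
have [hu e] := jouk_invP r0 Ez; set u := J _ in hu e.
have u0 : 0 < modc u by exact: lt_trans hu.
have hu2 : modc z ^+ 2 / 4 <= modc u.
  have := modc_jouk m r0 hu; rewrite e => h1.
  have := lerB_modc (z ^+ n) m%:C; rewrite modcX modcR_ge0 ?(ltW m0)// => h2.
  have h3 : m * 1 <= modc z / 2 * modc z.
    by apply: ler_pM => //; [exact: ltW|move: r0; lra].
  by rewrite expr2 in zz *; lra.
rewrite /lemn_map -/u; set v := proot _ _.
have v1 : modc (v - 1) <= p1 / modc u.
  apply: le_trans (proot_sub1 n0 (half hu)) _.
  by rewrite addrAC subrr add0r modc_div modcR_ge0// ltW.
have p1u : p1 / modc u <= 4 * p1 / modc z ^+ 2.
  rewrite ler_pdivrMr// mulrAC ler_pdivlMr ?exprn_gt0//.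
  have : p1 * (modc z ^+ 2 / 4) <= p1 * modc u by rewrite ler_wpM2l// ltW.
  by lra.
have pz : 4 * p1 / modc z ^+ 2 <= 1 / 2.
  rewrite ler_pdivrMr ?exprn_gt0//.
  have : 4 * (1 + m + 2 * r) * 1 <= modc z * modc z.
    by apply: ler_pM => //; [move: r0; lra|exact: ltW].
  by rewrite -expr2; move: r0 m0 p1r; lra.
have v0 : v != 0 by rewrite /v proot_neq0// half.
have v2 : 1 / 2 <= modc v.
  have := lerB_modc 1 (1 - v); rewrite (_ : 1 - (1 - v) = v); last by ring.
  by rewrite modc1 modc_distC; lra.
have -> : z / v - z = - (z * (v - 1) / v) by field.
rewrite modcN modc_div modcM ler_pdivrMr ?(lt_le_trans _ v2)//.
have -> : 8 * p1 / modc z * modc v = modc z * (4 * p1 / modc z ^+ 2) * (2 * modc v).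
  by field; rewrite gt_eqF.
rewrite -[leLHS]mulr1; apply: ler_pM; rewrite ?mulr_ge0 ?modc_ge0//; last by lra.
by rewrite ler_wpM2l ?modc_ge0//; lra.
Qed.

Lemma lemniscatic_map_radial : lemniscatic_map E radial_lemn lemn_map.
Proof.
split; [|exact: lemn_map_bij|exact: lemn_map_conformal|exact: lemn_map_infty].
by rewrite capacity_preim_segment.
Qed.

End RadialMap.

(** * Integrals of complex-valued functions over the unit interval *)

Section RealIntegral.
Variable R : realType.
Implicit Types (f g F : R -> R).

Local Notation mu := lebesgue_measure.
Local Notation I01 := `[0 : R, 1 : R]%classic.

Lemma continuous_integrable01 f : continuous f -> mu.-integrable I01 (EFin \o f).
Proof.
move=> cf; apply: continuous_compact_integrable; first exact: segment_compact.
exact: continuous_subspaceT.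
Qed.

Lemma Rintegral01_FTC F f : (forall t, is_derive t (1 : R) F (f t)) -> continuous f ->
  \int[mu]_(t in I01) f t = F 1 - F 0.
Proof.
move=> dF cf.
have cF : continuous F.
  move=> t; apply: differentiable_continuous; rewrite -derivable1_diffP.
  by have [] := dF t.
rewrite /Rintegral (continuous_FTC2 (F := F) ltr01)//.
- exact: continuous_subspaceT.
- split=> [t _||]; first by have [] := dF t.
  + by apply: cvg_at_right_filter; exact: cF.
  + by apply: cvg_at_left_filter; exact: cF.
- by move=> t _; rewrite derive1E; have [_ ->] := dF t.
Qed.

Lemma Rintegral01_le f (K : R) : continuous f -> (forall t, `|f t| <= K) ->
  `|\int[mu]_(t in I01) f t| <= K.
Proof.
move=> cf fK; apply: le_trans (le_normr_Rintegral _ (continuous_integrable01 cf)) _ => //.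
have cnf : continuous (fun t => `|f t|).
  by move=> t; apply: (cvg_comp _ _ (cf t)); exact: norm_continuous.
have ck : continuous (cst K : R -> R) by move=> t; exact: cvg_cst.
apply: (@le_trans _ _ (\int[mu]_(t in I01) (cst K t))).
  by apply: le_Rintegral => //; exact: continuous_integrable01.
by rewrite Rintegral_cst//= lebesgue_measure_itv/= lte_fin ltr01 oppr0 adde0/= mulr1.
Qed.

End RealIntegral.

Section ComplexIntegral.
Variable R : realType.
Implicit Types (f g F G : R -> R[i]) (c z : R[i]).

Definition ccont f : Prop :=
  continuous (fun t => complex.Re (f t)) /\ continuous (fun t => complex.Im (f t)).

Definition cderiv f g : Prop := forall t : R,
  is_derive t (1 : R) (fun t => complex.Re (f t)) (complex.Re (g t)) /\
  is_derive t (1 : R) (fun t => complex.Im (f t)) (complex.Im (g t)).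

Lemma ccont_cst c : ccont (fun=> c).
Proof. by split; exact: cst_continuous. Qed.

Lemma ccontD f g : ccont f -> ccont g -> ccont (fun t => f t + g t).
Proof.
move=> [f1 f2] [g1 g2]; split.
  under eq_fun do rewrite ReD.
  by move=> t; apply: cvgD; [exact: f1|exact: g1].
under eq_fun do rewrite ImD.
by move=> t; apply: cvgD; [exact: f2|exact: g2].
Qed.

Lemma ccontM f g : ccont f -> ccont g -> ccont (fun t => f t * g t).
Proof.
move=> [f1 f2] [g1 g2]; split.
  under eq_fun do rewrite ReM.
  move=> t; apply: cvgB; apply: cvgM;
    by [exact: f1|exact: g1|exact: f2|exact: g2].
under eq_fun do rewrite ImM.
move=> t; apply: cvgD; apply: cvgM;
  by [exact: f1|exact: g1|exact: f2|exact: g2].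
Qed.

Lemma ccontX f k : ccont f -> ccont (fun t => f t ^+ k).
Proof.
move=> cf; elim: k => [|k ih]; first exact: ccont_cst.
under eq_fun do rewrite exprS.
exact: ccontM.
Qed.

Lemma Re_inv z : complex.Re z^-1 = complex.Re z / (complex.Re z ^+ 2 + complex.Im z ^+ 2).
Proof. by case: z. Qed.

Lemma Im_inv z : complex.Im z^-1 = - (complex.Im z / (complex.Re z ^+ 2 + complex.Im z ^+ 2)).
Proof. by case: z. Qed.

Lemma sqr_modc_neq0 z : z != 0 -> complex.Re z ^+ 2 + complex.Im z ^+ 2 != 0.
Proof. by rewrite -sqr_modc sqrf_eq0 modc_eq0. Qed.

Lemma ccontV f : (forall t, f t != 0) -> ccont f -> ccont (fun t => (f t)^-1).
Proof.
move=> f0 [f1 f2].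
have cn : continuous (fun t => (complex.Re (f t) ^+ 2 + complex.Im (f t) ^+ 2)^-1).
  move=> t; apply: cvgV; first exact: sqr_modc_neq0 (f0 t).
  under eq_fun do rewrite !expr2.
  by apply: cvgD; apply: cvgM; by [exact: f1|exact: f2].
split.
  under eq_fun do rewrite Re_inv.
  by move=> t; apply: cvgM; [exact: f1|exact: cn].
under eq_fun do rewrite Im_inv.
by move=> t; apply: cvgN; apply: cvgM; [exact: f2|exact: cn].
Qed.

Lemma cderiv_cont f g : cderiv f g -> ccont f.
Proof.
move=> d; split=> t; apply: differentiable_continuous; rewrite -derivable1_diffP.
  by have [[]] := d t.
by have [_ []] := d t.
Qed.

Lemma cderiv_cst c : cderiv (fun=> c) (fun=> 0).
Proof. by move=> t; split; exact: is_derive_cst. Qed.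

Lemma cderivD f g F G : cderiv f F -> cderiv g G ->
  cderiv (fun t => f t + g t) (fun t => F t + G t).
Proof.
move=> df dg t; have [f1 f2] := df t; have [g1 g2] := dg t; split.
  under eq_fun do rewrite ReD.
  by rewrite ReD; exact: is_deriveD.
under eq_fun do rewrite ImD.
by rewrite ImD; exact: is_deriveD.
Qed.

Lemma cderivM f g F G : cderiv f F -> cderiv g G ->
  cderiv (fun t => f t * g t) (fun t => F t * g t + f t * G t).
Proof.
move=> df dg t; have [f1 f2] := df t; have [g1 g2] := dg t; split.
  under eq_fun do rewrite ReM.
  apply: is_derive_eq; rewrite ReD !ReM /GRing.scale/=; ring.
under eq_fun do rewrite ImM.
by apply: is_derive_eq; rewrite ImD !ImM /GRing.scale/=; ring.
Qed.

Lemma cderivV f F : (forall t, f t != 0) -> cderiv f F ->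
  cderiv (fun t => (f t)^-1) (fun t => - F t / (f t * f t)).
Proof.
move=> f0 df t; have [f1 f2] := df t; have n0 := sqr_modc_neq0 (f0 t).
have dn : is_derive t (1 : R)
    (fun t => (complex.Re (f t) ^+ 2 + complex.Im (f t) ^+ 2)^-1)
    (- (2 * (complex.Re (f t) * complex.Re (F t) + complex.Im (f t) * complex.Im (F t))) /
     (complex.Re (f t) ^+ 2 + complex.Im (f t) ^+ 2) ^+ 2).
  have d2 : is_derive t (1 : R)
      (fun t => complex.Re (f t) ^+ 2 + complex.Im (f t) ^+ 2)
      (2 * (complex.Re (f t) * complex.Re (F t) + complex.Im (f t) * complex.Im (F t))).
    by apply: is_derive_eq; rewrite /GRing.scale/=; ring.
  have d3 := @is_deriveV R (fun t => complex.Re (f t) ^+ 2 + complex.Im (f t) ^+ 2) t _ 1 n0 d2.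
  apply: (is_derive_eq d3).
  by rewrite /GRing.scale/=; field.
have -> : - F t / (f t * f t) = (- F t) * ((f t)^-1 * (f t)^-1) by rewrite invfM.
split.
  under eq_fun do rewrite Re_inv.
  have d := is_deriveM f1 dn; apply: (is_derive_eq d).
  by rewrite !ReM !ImM !Re_inv !Im_inv ReN ImN /GRing.scale/=; field.
under eq_fun do rewrite Im_inv.
have d := is_deriveN (is_deriveM f2 dn); apply: (is_derive_eq d).
by rewrite !ImM !ReM !Re_inv !Im_inv ReN ImN /GRing.scale/=; field.
Qed.

Lemma cderivX f F k : cderiv f F ->
  cderiv (fun t => f t ^+ k.+1) (fun t => k.+1%:R * (f t ^+ k * F t)).
Proof.
move=> df; elim: k => [|k ih].
  by under [X in cderiv _ X]eq_fun do rewrite expr0 !mul1r.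
have := cderivM df ih.
under [X in cderiv X _]eq_fun do rewrite -exprS.
rewrite (_ : (fun t => F t * _ + _) = (fun t => k.+2%:R * (f t ^+ k.+1 * F t)))//.
by apply/funext => t; rewrite -[k.+2%:R]natr1 [f t ^+ k.+1]exprS; ring.
Qed.

Lemma integral01D f g : ccont f -> ccont g ->
  integral01 (fun t => f t + g t) = integral01 f + integral01 g.
Proof.
move=> [f1 f2] [g1 g2]; rewrite /integral01.
under eq_Rintegral do rewrite ReD.
under [X in _ +i* X]eq_Rintegral do rewrite ImD.
by rewrite !RintegralD//; exact: continuous_integrable01.
Qed.

Lemma integral01Z f c : ccont f ->
  integral01 (fun t => c * f t) = c * integral01 f.
Proof.
move=> [f1 f2].
have i1 a := continuous_integrable01 (f := fun t => a * complex.Re (f t))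
  (fun t => cvgM (cvg_cst a) (f1 t)).
have i2 a := continuous_integrable01 (f := fun t => a * complex.Im (f t))
  (fun t => cvgM (cvg_cst a) (f2 t)).
rewrite /integral01.
under eq_Rintegral do rewrite ReM.
under [X in _ +i* X]eq_Rintegral do rewrite ImM.
rewrite RintegralB//; [|exact: i1|exact: i2].
rewrite RintegralD//; [|exact: i2|exact: i1].
rewrite !RintegralZl//; try exact: continuous_integrable01.
by case: c {i1 i2} => a b; simpc.
Qed.

Lemma integral01_exact F f : cderiv F f -> ccont f -> integral01 f = F 1 - F 0.
Proof.
move=> dF [f1 f2]; rewrite /integral01.
rewrite (Rintegral01_FTC (fun t => (dF t).1) f1).
rewrite (Rintegral01_FTC (fun t => (dF t).2) f2).
by case: (F 1) (F 0) => ? ? [? ?]; simpc.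
Qed.

Lemma integral01_le f K : ccont f -> (forall t, modc (f t) <= K) ->
  modc (integral01 f) <= 2 * K.
Proof.
move=> [f1 f2] fK; apply: le_trans (modc_le_ReIm _) _; rewrite mulr_natl mulr2n.
apply: lerD; apply: Rintegral01_le => // t; apply: le_trans (fK t).
  exact: Re_le_modc.
exact: Im_le_modc.
Qed.

End ComplexIntegral.

(** * Winding numbers by homotopy *)

Section QuadraticModulus.
Variable R : realType.

(** Such a function has zero derivative. Subdivision of the interval into k
    pieces bounds the increment by K / k. *)
Lemma quadratic_modulus_const (F : R -> R[i]) (K : R) :
  (forall x y : R, 0 <= x <= 1 -> 0 <= y <= 1 -> modc (F x - F y) <= K * (x - y) ^+ 2) ->
  F 0 = F 1.
Proof.
move=> h; have h01 : forall k : nat, modc (F 0 - F 1) <= K / k.+1%:R.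
  move=> k; have k0 : (0 : R) < k.+1%:R by rewrite ltr0n.
  pose x (i : nat) : R := i%:R / k.+1%:R.
  have x01 i : (i <= k.+1)%N -> 0 <= x i <= 1.
    by move=> ik; rewrite divr_ge0//= ler_pdivrMr// mul1r ler_nat.
  have st (j : nat) : (j <= k.+1)%N -> modc (F 0 - F (x j)) <= j%:R * (K / k.+1%:R ^+ 2).
    elim: j => [|j ih] jk; first by rewrite /x mul0r subrr modc0 mul0r.
    have -> : F 0 - F (x j.+1) = (F 0 - F (x j)) + (F (x j) - F (x j.+1)) by ring.
    apply: le_trans (ler_modcD _ _) _; rewrite -natr1 mulrDl mul1r.
    apply: lerD; first by apply: ih; exact: ltnW.
    apply: le_trans (h _ _ (x01 _ (ltnW jk)) (x01 _ jk)) _.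
    rewrite le_eqVlt; apply/orP; left; apply/eqP.
    by rewrite /x -natr1; field; rewrite gt_eqF.
  have := st k.+1 (leqnn _); rewrite {1}/x divff ?gt_eqF// => /le_trans; apply.
  rewrite le_eqVlt; apply/orP; left; apply/eqP.
  by field; rewrite gt_eqF.
apply/eqP; rewrite -subr_eq0 -modc_eq0 eq_le modc_ge0 andbT leNgt; apply/negP => e0.
set e := modc _ in h01 e0.
have K0 : 0 <= K by have := h01 0%N; rewrite divr1; lra.
have k1 := archi_boundP (divr_ge0 K0 (ltW e0)).
have := h01 (Num.bound (K / e)); rewrite ler_pdivlMr ?ltr0n//.
rewrite ltr_pdivrMr// in k1; apply/negP; rewrite -ltNge.
apply: lt_le_trans k1 _; rewrite mulrC ler_pM2l// ler_nat//.
Qed.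

End QuadraticModulus.

Lemma integral01_lin (R : realType) (f g h : R -> R[i]) (a b : R[i]) :
  ccont f -> ccont g -> ccont h ->
  integral01 (fun t => f t + (a * g t + b * h t)) =
  integral01 f + (a * integral01 g + b * integral01 h).
Proof.
move=> cf cg ch; have Z c k : ccont k -> ccont (fun t => c * k t).
  by move=> ck; apply: ccontM => //; exact: ccont_cst.
by rewrite !integral01D ?integral01Z//; [exact: Z|exact: Z|apply: ccontD; exact: Z].
Qed.

Section ClosedCurve.
Variables (R : realType) (gam gam' : R -> R[i]) (B : R).
Hypotheses (dgam : cderiv gam gam') (cgam' : ccont gam').
Hypothesis closed : gam 0 = gam 1.
Hypothesis gamB : forall t, modc (gam' t) <= B.
Implicit Types (z : R[i]) (p q : {poly R[i]}).

Let cgam : ccont gam. Proof. exact: cderiv_cont dgam. Qed.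

(** A polynomial has a primitive, and the curve is closed. *)
Lemma integral01_poly q : integral01 (fun t => q.[gam t] * gam' t) = 0.
Proof.
have -> : (fun t => q.[gam t] * gam' t) =
    (fun t => (\sum_(i < size q) q`_i * gam t ^+ i) * gam' t).
  by apply/funext => t; rewrite horner_coef.
suff [] : integral01 (fun t => (\sum_(i < size q) q`_i * gam t ^+ i) * gam' t) = 0 /\
  ccont (fun t => (\sum_(i < size q) q`_i * gam t ^+ i) * gam' t) by [].
elim: (size q) => [|k [ih1 ih2]].
  have -> : (fun t => (\sum_(i < 0) q`_i * gam t ^+ i) * gam' t) = (fun t => 0 * gam' t).
    by apply/funext => t; rewrite big_ord0.
  by rewrite integral01Z// mul0r; split=> //; apply: ccontM => //; exact: ccont_cst.
have ck : ccont (fun t => gam t ^+ k * gam' t) by apply: ccontM => //; exact: ccontX.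
have -> : (fun t => (\sum_(i < k.+1) q`_i * gam t ^+ i) * gam' t) =
    (fun t => (\sum_(i < k) q`_i * gam t ^+ i) * gam' t + q`_k * (gam t ^+ k * gam' t)).
  by apply/funext => t; rewrite big_ord_recr/= mulrDl mulrA.
have cq : ccont (fun t => q`_k * (gam t ^+ k * gam' t)).
  by apply: ccontM => //; exact: ccont_cst.
split; last exact: ccontD.
rewrite integral01D// integral01Z// ih1 add0r.
have ck' : ccont (fun t => k.+1%:R * (gam t ^+ k * gam' t)).
  by apply: ccontM => //; exact: ccont_cst.
have := integral01_exact (cderivX k dgam) ck'.
rewrite integral01Z// closed subrr => /eqP; rewrite mulf_eq0 pnatr_eq0/=.
by move=> /eqP ->; rewrite mulr0.
Qed.

Section AwayFromPoint.
Variable z : R[i].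
Hypothesis gamz : forall t, gam t - z != 0.

Let cinv : ccont (fun t => (gam t - z)^-1 * gam' t).
Proof.
apply: ccontM => //; apply: ccontV => //; apply: ccontD => //; exact: ccont_cst.
Qed.

Lemma ccont_poly q : ccont (fun t => q.[gam t]).
Proof.
elim/poly_ind: q => [|q c ih].
  by under eq_fun do rewrite horner0; exact: ccont_cst.
under eq_fun do rewrite hornerMXaddC.
by apply: ccontD; [exact: ccontM|exact: ccont_cst].
Qed.

(** Cauchy formula for polynomials: division by X - z leaves the value at z as
    the remainder. *)
Lemma cauchy_poly p :
  integral01 (fun t => p.[gam t] / (gam t - z) * gam' t) =
  p.[z] * integral01 (fun t => (gam t - z)^-1 * gam' t).
Proof.
have /factor_theorem[q pE] : root (p - p.[z]%:P) z by rewrite /root !hornerE subrr.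
have -> : (fun t => p.[gam t] / (gam t - z) * gam' t) =
    (fun t => p.[z] * ((gam t - z)^-1 * gam' t) + q.[gam t] * gam' t).
  apply/funext => t; have e : p.[gam t] = q.[gam t] * (gam t - z) + p.[z].
    rewrite -{1}[p](subrK p.[z]%:P) hornerD pE hornerC hornerM; congr (_ * _ + _).
    exact: hornerXsubC.
  by rewrite e; field.
rewrite integral01D ?integral01Z ?integral01_poly ?addr0//.
  by apply: ccontM => //; exact: ccont_cst.
by apply: ccontM => //; exact: ccont_poly.
Qed.

End AwayFromPoint.

(* Applied with c proportional to a displacement of the pole: the remainder
   makes the variation of the integral quadratic in it. *)
Let inv_expand (A c : R[i]) : A != 0 -> A - c != 0 ->
  (A - c)^-1 = A^-1 + c * (A^-1 * A^-1) + c ^+ 2 * (A^-1 * A^-1 * (A - c)^-1).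
Proof. by move=> A0 c0; field; rewrite A0 c0. Qed.

(** Moving the pole from z to 0 along the segment that joins them does not
    change the integral: the first-order variation of the integrand is the
    derivative of a closed function. *)
Lemma winding_star z (delta : R) : 0 < delta ->
  (forall t x : R, 0 <= x <= 1 -> delta <= modc (gam t - x%:C * z)) ->
  integral01 (fun t => (gam t - z)^-1 * gam' t) =
  integral01 (fun t => (gam t)^-1 * gam' t).
Proof.
move=> d0 dist; pose A (x : R) t := gam t - x%:C * z.
pose F (x : R) := integral01 (fun t => (A x t)^-1 * gam' t).
have A0 x t : 0 <= x <= 1 -> A x t != 0.
  by move=> x01; rewrite -modc_gt0; apply: lt_le_trans d0 (dist _ _ x01).
have cA x : ccont (A x) by apply: ccontD => //; exact: ccont_cst.
have dA x : cderiv (A x) gam'.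
  have := cderivD dgam (cderiv_cst (- (x%:C * z))).
  by congr cderiv; apply/funext => t; rewrite addr0.
have F01 : F 0 = F 1; last first.
  transitivity (F 1); first by congr integral01; apply/funext => t; rewrite /A mul1r.
  by rewrite -F01; congr integral01; apply/funext => t; rewrite /A mul0r subr0.
have B0 : 0 <= B by apply: le_trans (gamB 0); exact: modc_ge0.
apply: (@quadratic_modulus_const _ _ (2 * (modc z ^+ 2 * (delta ^- 3 * B)))) => x y x01 y01.
have cAV (w : R) : 0 <= w <= 1 -> ccont (fun t => (A w t)^-1).
  by move=> w01; apply: ccontV => // t; exact: A0.
pose c := (x - y)%:C * z.
have cy : ccont (fun t => (A y t)^-1 * gam' t) by apply: ccontM => //; exact: cAV.
have c1 : ccont (fun t => (A y t)^-1 * (A y t)^-1 * gam' t).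
  by apply: ccontM => //; apply: ccontM; exact: cAV.
have c2 : ccont (fun t => (A y t)^-1 * (A y t)^-1 * (A x t)^-1 * gam' t).
  by apply: ccontM => //; apply: ccontM; [apply: ccontM|]; exact: cAV.
have e1 : integral01 (fun t => (A y t)^-1 * (A y t)^-1 * gam' t) = 0.
  have d1 := cderivM (cderiv_cst (-1)) (cderivV (fun t => A0 y t y01) (dA y)).
  have -> : (fun t => (A y t)^-1 * (A y t)^-1 * gam' t) =
      (fun t => 0 * (A y t)^-1 + -1 * (- gam' t / (A y t * A y t))).
    by apply/funext => t; rewrite mul0r add0r invfM; ring.
  rewrite (integral01_exact d1).
    by rewrite /A closed subrr.
  have -> : (fun t => 0 * (A y t)^-1 + -1 * (- gam' t / (A y t * A y t))) =
      (fun t => (A y t)^-1 * (A y t)^-1 * gam' t).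
    by apply/funext => t; rewrite mul0r add0r invfM; ring.
  exact: c1.
have -> : F x - F y = c ^+ 2 * integral01 (fun t => (A y t)^-1 * (A y t)^-1 * (A x t)^-1 * gam' t).
  rewrite /F; have -> : (fun t => (A x t)^-1 * gam' t) = (fun t => (A y t)^-1 * gam' t +
      (c * ((A y t)^-1 * (A y t)^-1 * gam' t) +
       c ^+ 2 * ((A y t)^-1 * (A y t)^-1 * (A x t)^-1 * gam' t))).
    apply/funext => t; have Ex : A x t = A y t - c by rewrite /A /c realCB; ring.
    by rewrite Ex {1}inv_expand -?Ex ?A0//; ring.
  by rewrite (integral01_lin _ _ cy c1 c2) e1; ring.
rewrite modcM /c modcX modcM modcR exprMn real_normK ?num_real//.
have -> : 2 * (modc z ^+ 2 * (delta ^- 3 * B)) * (x - y) ^+ 2 =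
  (x - y) ^+ 2 * modc z ^+ 2 * (2 * (delta ^- 3 * B)) by ring.
rewrite (ler_wpM2l (mulr_ge0 (sqr_ge0 _) (sqr_ge0 _)))//; apply: integral01_le => // t.
rewrite !modcM !modcV ler_pM ?mulr_ge0 ?invr_ge0 ?modc_ge0//.
rewrite !exprSr expr0 mul1r !invfM.
have hi (w : R) : 0 <= w <= 1 -> (modc (A w t))^-1 <= delta^-1.
  by move=> w01; rewrite lef_pV2 ?posrE ?dist// (lt_le_trans d0)// dist.
by apply: ler_pM; rewrite ?mulr_ge0 ?invr_ge0 ?modc_ge0 ?hi//; apply: ler_pM;
  rewrite ?mulr_ge0 ?invr_ge0 ?modc_ge0 ?hi.
Qed.

(** Symmetrically, shrinking the curve to the origin removes it from the
    exterior points that it does not sweep. *)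
Lemma winding_costar z (delta G : R) : 0 < delta -> (forall t, modc (gam t) <= G) ->
  (forall t x : R, 0 <= x <= 1 -> delta <= modc (x%:C * gam t - z)) ->
  integral01 (fun t => (gam t - z)^-1 * gam' t) = 0.
Proof.
move=> d0 gG dist; pose A (x : R) t := x%:C * gam t - z.
pose F (x : R) := integral01 (fun t => x%:C * ((A x t)^-1 * gam' t)).
have A0 x t : 0 <= x <= 1 -> A x t != 0.
  by move=> x01; rewrite -modc_gt0; apply: lt_le_trans d0 (dist _ _ x01).
have cA x : ccont (A x).
  by apply: ccontD; [apply: ccontM => //|]; exact: ccont_cst.
have dA x : cderiv (A x) (fun t => x%:C * gam' t).
  have := cderivD (cderivM (cderiv_cst x%:C) dgam) (cderiv_cst (- z)).
  by congr cderiv; apply/funext => t; rewrite addr0 mul0r add0r.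
have F01 : F 0 = F 1; last first.
  transitivity (F 1); first by congr integral01; apply/funext => t; rewrite /A !mul1r.
  rewrite -F01 /F integral01Z ?mul0r//.
  apply: ccontM => //; apply: ccontV => // t; apply: A0.
  by rewrite lexx ler01.
have B0 : 0 <= B by apply: le_trans (gamB 0); exact: modc_ge0.
have G0 : 0 <= G by apply: le_trans (gG 0); exact: modc_ge0.
apply: (@quadratic_modulus_const _ _ (2 * (modc z * (G * delta ^- 3 * B)))) => x y x01 y01.
have cAV (w : R) : 0 <= w <= 1 -> ccont (fun t => (A w t)^-1).
  by move=> w01; apply: ccontV => // t; exact: A0.
have cy : ccont (fun t => y%:C * ((A y t)^-1 * gam' t)).
  by apply: ccontM; [exact: ccont_cst|apply: ccontM => //; exact: cAV].
have c1 : ccont (fun t => - z * ((A y t)^-1 * (A y t)^-1 * gam' t)).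
  apply: ccontM; first exact: ccont_cst.
  by apply: ccontM => //; apply: ccontM; exact: cAV.
have c2 : ccont (fun t => gam t * ((A y t)^-1 * (A y t)^-1 * (A x t)^-1) * gam' t).
  apply: ccontM => //; apply: ccontM => //.
  by apply: ccontM; [apply: ccontM|]; exact: cAV.
have e1 : integral01 (fun t => - z * ((A y t)^-1 * (A y t)^-1 * gam' t)) = 0.
  have d1 := cderivM dgam (cderivV (fun t => A0 y t y01) (dA y)).
  have E : (fun t => gam' t * (A y t)^-1 + gam t * (- (y%:C * gam' t) / (A y t * A y t))) =
      (fun t => - z * ((A y t)^-1 * (A y t)^-1 * gam' t)).
    apply/funext => t; have := A0 y t y01; rewrite /A => h.
    by field.
  rewrite E in d1; rewrite (integral01_exact d1)//.
  by rewrite /A closed subrr.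
have -> : F x - F y = (x - y)%:C ^+ 2 * z *
    integral01 (fun t => gam t * ((A y t)^-1 * (A y t)^-1 * (A x t)^-1) * gam' t).
  rewrite /F; have -> : (fun t => x%:C * ((A x t)^-1 * gam' t)) =
      (fun t => y%:C * ((A y t)^-1 * gam' t) +
      ((x - y)%:C * (- z * ((A y t)^-1 * (A y t)^-1 * gam' t)) +
       (x - y)%:C ^+ 2 * z *
         (gam t * ((A y t)^-1 * (A y t)^-1 * (A x t)^-1) * gam' t))).
    apply/funext => t; have := A0 y t y01; have := A0 x t x01; rewrite /A realCB => hx hy.
    by field; rewrite hx hy.
  by rewrite (integral01_lin _ _ cy c1 c2) e1; ring.
rewrite modcM [modc (_ * z)]modcM modcX modcR real_normK ?num_real//.
have -> : 2 * (modc z * (G * delta ^- 3 * B)) * (x - y) ^+ 2 =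
  (x - y) ^+ 2 * modc z * (2 * (G * delta ^- 3 * B)) by ring.
rewrite (ler_wpM2l (mulr_ge0 (sqr_ge0 _) (modc_ge0 _)))//; apply: integral01_le => // t.
rewrite !modcM !modcV ler_pM ?mulr_ge0 ?invr_ge0 ?modc_ge0//.
rewrite ler_pM ?mulr_ge0 ?invr_ge0 ?modc_ge0//.
rewrite !exprSr expr0 mul1r !invfM.
have hi (w : R) : 0 <= w <= 1 -> (modc (A w t))^-1 <= delta^-1.
  by move=> w01; rewrite lef_pV2 ?posrE ?dist// (lt_le_trans d0)// dist.
by apply: ler_pM; rewrite ?mulr_ge0 ?invr_ge0 ?modc_ge0 ?hi//; apply: ler_pM;
  rewrite ?mulr_ge0 ?invr_ge0 ?modc_ge0 ?hi.
Qed.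

End ClosedCurve.

(** * Level curves as n-th roots of ellipses *)

Section LogDerivative.
Variable R : realType.
Implicit Types (f g q : R -> R[i]) (a b : R -> R).

Lemma cderiv_expi (c : R) :
  cderiv (fun t => expi (c * t)) (fun t => (0 +i* c) * expi (c * t)).
Proof.
move=> t; have dc : is_derive t (1 : R) (fun t : R => c * t) c.
  have d := is_deriveZ c (is_derive_id t (1 : R)); apply: (is_derive_eq d).
  by rewrite /GRing.scale/= mulr1.
split; rewrite /expi/=.
  have d := is_derive1_comp (is_derive_cos (c * t)) dc; apply: (is_derive_eq d); ring.
have d := is_derive1_comp (is_derive_sin (c * t)) dc; apply: (is_derive_eq d); ring.
Qed.

Lemma cderiv_polar a b a' b' :
  (forall t, is_derive t (1 : R) a (a' t)) -> (forall t, is_derive t (1 : R) b (b' t)) ->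
  cderiv (fun t => (expR (a t))%:C * expi (b t))
         (fun t => (expR (a t))%:C * expi (b t) * (a' t +i* b' t)).
Proof.
move=> da db t.
have de := is_derive1_comp (is_derive_expR (a t)) (da t).
have dcos := is_derive1_comp (is_derive_cos (b t)) (db t).
have dsin := is_derive1_comp (is_derive_sin (b t)) (db t).
split.
  under eq_fun do rewrite Re_scale/=.
  have d := is_deriveM de dcos; apply: (is_derive_eq d).
  by rewrite ReM Re_scale Im_scale /GRing.scale/=; ring.
under eq_fun do rewrite Im_scale/=.
have d := is_deriveM de dsin; apply: (is_derive_eq d).
by rewrite ImM Re_scale Im_scale /GRing.scale/=; ring.
Qed.

Lemma is_derive_ln_modc q q' : (forall t, q t != 0) -> cderiv q q' ->
  forall t, is_derive t (1 : R) (fun t => ln (modc (q t))) (complex.Re (q' t / q t)).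
Proof.
move=> q0 dq t; have [d1 d2] := dq t.
have n0 : 0 < complex.Re (q t) ^+ 2 + complex.Im (q t) ^+ 2.
  by rewrite -sqr_modc exprn_gt0// modc_gt0.
have dn : is_derive t (1 : R)
    (fun t => complex.Re (q t) ^+ 2 + complex.Im (q t) ^+ 2)
    (2 * (complex.Re (q t) * complex.Re (q' t) + complex.Im (q t) * complex.Im (q' t))).
  by apply: is_derive_eq; rewrite /GRing.scale/=; ring.
have -> : (fun t => ln (modc (q t))) =
    (fun t => 2^-1 * ln (complex.Re (q t) ^+ 2 + complex.Im (q t) ^+ 2)).
  apply/funext => s; rewrite -sqr_modc lnXn ?modc_gt0//.
  by rewrite -[ln _ *+ 2]mulr_natl mulrA mulVf ?mul1r.
have dl := is_deriveZ 2^-1 (@is_derive1_comp _ (@ln R)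
  (fun t => complex.Re (q t) ^+ 2 + complex.Im (q t) ^+ 2) t _ _ (is_derive1_ln n0) dn).
apply: (is_derive_eq dl); rewrite ReM Re_inv Im_inv /GRing.scale/=.
by field; rewrite gt_eqF.
Qed.

Lemma is_derive_parg q q' : (forall t, 0 < complex.Re (q t)) -> cderiv q q' ->
  forall t, is_derive t (1 : R) (fun t => parg (q t)) (complex.Im (q' t / q t)).
Proof.
move=> q0 dq t; have [d1 d2] := dq t.
have r0 : complex.Re (q t) != 0 by rewrite gt_eqF.
have n0 : complex.Re (q t) ^+ 2 + complex.Im (q t) ^+ 2 != 0.
  by rewrite gt_eqF// ltr_wpDr ?sqr_ge0// exprn_gt0.
have dV := @is_deriveV R (fun t => complex.Re (q t)) t _ 1 r0 d1.
have d := @is_derive1_comp _ (@atan R) (fun t => complex.Im (q t) / complex.Re (q t)) t _ _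
  (is_derive1_atan (complex.Im (q t) / complex.Re (q t))) (is_deriveM d2 dV).
apply: (is_derive_eq d); rewrite ImM Re_inv Im_inv /GRing.scale/=.
field; apply/andP; split; [exact: n0|exact: r0].
Qed.

End LogDerivative.

Section LevelCurve.
Variables (R : realType) (m r : R).
Hypotheses (r0 : 0 < r) (rm : 2 * r < m).
Variable n : nat.
Hypothesis n0 : (0 < n)%N.
Variable rho : R.
Hypothesis rho_ge : 4 * m <= rho.
Implicit Types (t x : R) (z u : R[i]).

Let nR0 : (0 : R) < n%:R. Proof. by rewrite ltr0n. Qed.
Let m0 : 0 < m. Proof. by move: r0 rm; lra. Qed.
Let rho0 : 0 < rho. Proof. by move: m0 rho_ge; lra. Qed.

Let A := m / rho.
Let B := r ^+ 2 / rho ^+ 2.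

Let A0 : 0 < A. Proof. exact: divr_gt0. Qed.
Let B0 : 0 < B. Proof. by rewrite divr_gt0// exprn_gt0. Qed.
Let A1 : A <= 1 / 4. Proof. by rewrite ler_pdivrMr//; move: rho_ge; lra. Qed.
Let B1 : B <= 1 / 16.
Proof.
rewrite /B -expr_div_n (_ : 1 / 16 = (1 / 4) ^+ 2); last by rewrite expr_div_n; field.
rewrite ler_sqr ?nnegrE ?divr_ge0 ?(ltW r0) ?(ltW rho0)//.
by rewrite ler_pdivrMr//; move: r0 rm rho_ge; lra.
Qed.

Let w1 : R := - (2 * pi * n%:R).

(* The parametrization of the ellipse, divided by its leading Fourier term. For
   rho >= 4 m its values lie in the half-plane Re >= 1/2, where the principal
   root is smooth. *)
Let q t : R[i] := 1 + A%:C * expi (w1 * t) + B%:C * expi (2 * w1 * t).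
Let q' t : R[i] := A%:C * ((0 +i* w1) * expi (w1 * t)) +
  B%:C * ((0 +i* (2 * w1)) * expi (2 * w1 * t)).

Let q_half t : 1 / 2 <= complex.Re (q t).
Proof.
have h1 : - A <= complex.Re (A%:C * expi (w1 * t)).
  have := Re_le_modc (A%:C * expi (w1 * t)); rewrite modcM modc_expi mulr1.
  by rewrite modcR_ge0 ?(ltW A0)// ler_norml => /andP[].
have h2 : - B <= complex.Re (B%:C * expi (2 * w1 * t)).
  have := Re_le_modc (B%:C * expi (2 * w1 * t)); rewrite modcM modc_expi mulr1.
  by rewrite modcR_ge0 ?(ltW B0)// ler_norml => /andP[].
by rewrite /q !ReD [complex.Re 1]/=; move: A1 B1; lra.
Qed.

Let q_gt0 t : 0 < complex.Re (q t).
Proof. by apply: lt_le_trans (q_half t); rewrite divr_gt0. Qed.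

Let q_modc t : 1 / 2 <= modc (q t).
Proof. exact: le_trans (q_half t) (le_trans (ler_norm _) (Re_le_modc _)). Qed.

Let q_neq0 t : q t != 0.
Proof. by rewrite -modc_gt0; apply: lt_le_trans (q_modc t); rewrite divr_gt0. Qed.

Let q_le2 t : modc (q t) <= 2.
Proof.
apply: le_trans (ler_modcD _ _) _; rewrite modcM modc_expi mulr1 modcR_ge0 ?(ltW B0)//.
have := ler_modcD 1 (A%:C * expi (w1 * t)).
rewrite modc1 modcM modc_expi mulr1 modcR_ge0 ?(ltW A0)//.
by move: A1 B1; lra.
Qed.

Let dq : cderiv q q'.
Proof.
have := cderivD (cderivD (cderiv_cst 1) (cderivM (cderiv_cst A%:C) (cderiv_expi w1)))
  (cderivM (cderiv_cst B%:C) (cderiv_expi (2 * w1))).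
by congr cderiv; apply/funext => t; rewrite /q' !mul0r !add0r.
Qed.

Let cq' : ccont q'.
Proof.
have ce c : ccont (fun t : R => (0 +i* c) * expi (c * t)).
  by apply: ccontM; [exact: ccont_cst|exact: cderiv_cont (cderiv_expi c)].
by apply: ccontD; apply: ccontM => //; exact: ccont_cst.
Qed.

Let modc_i (c : R) : modc (0 +i* c) = `|c|.
Proof. by rewrite modcE/= expr0n add0r sqrtr_sqr. Qed.

Let q'_le t : modc (q' t) <= 2 * pi * n%:R.
Proof.
have pn : 0 <= 2 * pi * n%:R :> R by rewrite !mulr_ge0 ?pi_ge0.
apply: le_trans (ler_modcD _ _) _; rewrite !modcM !modc_expi !mulr1 !modc_i.
rewrite !modcR_ge0 ?(ltW A0) ?(ltW B0)// normrM /w1 normrN !ger0_norm//.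
set k := 2 * pi * n%:R in pn *.
have h1 : A * k <= 1 / 4 * k by rewrite ler_wpM2r.
have h2 : B * k <= 1 / 16 * k by rewrite ler_wpM2r.
by move: pn; lra.
Qed.

(** The curve is given by the logarithm of its modulus and its argument, hence
    its logarithmic derivative and its winding number about the origin can be
    read off. *)
Definition lcurve_log t : R := (ln rho + ln (modc (q t))) / n%:R.
Definition lcurve_arg t : R := 2 * pi * t + parg (q t) / n%:R.
Definition lcurve t : R[i] := (expR (lcurve_log t))%:C * expi (lcurve_arg t).
Definition lcurve_dlog t : R[i] := two_pi_i R + (n%:R^-1)%:C * (q' t / q t).
Definition lcurve' t : R[i] := lcurve t * lcurve_dlog t.

Let lcurve_dlogE t : lcurve_dlog t =
  (complex.Re (q' t / q t) / n%:R) +i* (2 * pi + complex.Im (q' t / q t) / n%:R).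
Proof.
rewrite /lcurve_dlog /two_pi_i; case: (q' t / q t) => a b /=; simpc.
by rewrite ![n%:R^-1 * _]mulrC.
Qed.

Let dlog t : is_derive t (1 : R) lcurve_log (complex.Re (lcurve_dlog t)).
Proof.
have d1 := is_derive_ln_modc q_neq0 dq t.
have d2 := is_derive_cst (ln rho) t (1 : R).
have d := is_deriveZ n%:R^-1 (is_deriveD d2 d1).
have -> : lcurve_log = (n%:R^-1 \*: (cst (ln rho) + (fun t => ln (modc (q t))))).
  by apply/funext => s; rewrite /lcurve_log /GRing.scale/= mulrC.
by apply: (is_derive_eq d); rewrite lcurve_dlogE /GRing.scale/= add0r mulrC.
Qed.

Let darg t : is_derive t (1 : R) lcurve_arg (complex.Im (lcurve_dlog t)).
Proof.
have d1 := is_deriveZ n%:R^-1 (is_derive_parg q_gt0 dq t).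
have d2 := is_deriveZ (2 * pi) (is_derive_id t (1 : R)).
have d := is_deriveD d2 d1.
have -> : lcurve_arg = ((2 * pi) \*: id) + (n%:R^-1 \*: (fun t => parg (q t))).
  by apply/funext => s; rewrite /lcurve_arg /GRing.scale/= [_ / _]mulrC.
by apply: (is_derive_eq d); rewrite lcurve_dlogE /GRing.scale/=; ring.
Qed.

Lemma dlcurve : cderiv lcurve lcurve'.
Proof.
by rewrite /lcurve'; have := cderiv_polar dlog darg; congr cderiv.
Qed.

Let cdlog : ccont lcurve_dlog.
Proof.
apply: ccontD; first exact: ccont_cst.
apply: ccontM; first exact: ccont_cst.
by apply: ccontM => //; apply: ccontV => //; exact: cderiv_cont dq.
Qed.

Lemma clcurve' : ccont lcurve'.
Proof. by apply: ccontM => //; exact: cderiv_cont dlcurve. Qed.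

Lemma lcurve_dlog_le t : modc (lcurve_dlog t) <= 6 * pi.
Proof.
apply: le_trans (ler_modcD _ _) _; rewrite /two_pi_i modc_i modcM modc_div.
have pi0 := pi_gt0 R.
rewrite modcR !ger0_norm ?invr_ge0 ?mulr_ge0 ?(ltW pi0)//.
have h : modc (q' t) / modc (q t) <= 2 * pi * n%:R * 2.
  rewrite ler_pdivrMr ?modc_gt0//; apply: le_trans (q'_le t) _.
  have : 2 * pi * n%:R * 2 * (1 / 2) <= 2 * pi * n%:R * 2 * modc (q t).
    by rewrite ler_wpM2l// !mulr_ge0// ltW.
  lra.
have : n%:R^-1 * (modc (q' t) / modc (q t)) <= n%:R^-1 * (2 * pi * n%:R * 2).
  by rewrite ler_wpM2l// invr_ge0 ltW.
rewrite (_ : n%:R^-1 * (2 * pi * n%:R * 2) = 4 * pi); last by field; rewrite gt_eqF.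
lra.
Qed.

Lemma modc_lcurve_expn t : modc (lcurve t) ^+ n = rho * modc (q t).
Proof.
rewrite modcM modc_expi mulr1 modcR_ge0 ?expR_ge0// -expRM_natl mulrC divfK ?gt_eqF//.
by rewrite expRD !lnK// posrE modc_gt0.
Qed.

Lemma lcurve_neq0 t : lcurve t != 0.
Proof. by rewrite mulf_neq0 ?expi_neq0// realC_eq0 gt_eqF// expR_gt0. Qed.

(** The n-th power of the curve runs n times through the image of the circle
    of radius rho. *)
Lemma lcurve_expn t :
  lcurve t ^+ n = jouk m r (rho%:C * expi (2 * pi * n%:R * t)).
Proof.
have rc : rho%:C != 0 :> R[i] by rewrite realC_eq0 gt_eqF.
transitivity (rho%:C * expi (2 * pi * n%:R * t) * q t).
  have e : n%:R * lcurve_log t = ln rho + ln (modc (q t)).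
    by rewrite mulrC divfK// gt_eqF.
  rewrite [q t in RHS]parg_polar// exprMn -realCX -expi_sum -expRM_natl.
  rewrite e expRD !lnK ?posrE ?modc_gt0// realCM.
  rewrite /lcurve_arg mulrDr expiD [n%:R * (_ / _)]mulrC divfK ?gt_eqF//.
  have -> : n%:R * (2 * pi * t) = 2 * pi * n%:R * t by ring.
  by ring.
rewrite /jouk /q /A /B /w1.
have -> : 2 * - (2 * pi * n%:R) * t = - (2 * pi * n%:R * t) + - (2 * pi * n%:R * t) by ring.
have -> : - (2 * pi * n%:R) * t = - (2 * pi * n%:R * t) by ring.
rewrite expiD !expiN !realCM !realCV !realCX.
by field; rewrite rc expi_neq0.
Qed.

Let q_shift t (j : nat) : q (t + j%:R / n%:R) = q t.
Proof.
have e (c : R) (i : nat) : expi (c * t - 2 * pi * i%:R) = expi (c * t).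
  rewrite expiD expiN mulrC -[X in X * _](_ : 1 = _) ?mul1r//.
  by rewrite [2 * pi * _]mulrC expi_sum expi2pi expr1n invr1.
rewrite /q; congr (_ + _ * _ + _ * _).
  by rewrite -(e w1 j); congr expi; rewrite /w1; field; rewrite gt_eqF.
rewrite -(e (2 * w1) (2 * j)%N); congr expi; rewrite /w1 natrM.
by field; rewrite gt_eqF.
Qed.

Lemma lcurve_shift t (j : nat) :
  lcurve (t + j%:R / n%:R) = lcurve t * omega R n ^+ j.
Proof.
rewrite /lcurve /lcurve_log /lcurve_arg q_shift omegaX -[RHS]mulrA -expiD.
by congr (_ * expi _); ring.
Qed.

Lemma lcurve_closed : lcurve 0 = lcurve 1.
Proof.
have := lcurve_shift 0 n; rewrite add0r divff ?gt_eqF// => ->.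
by rewrite omega_expn// mulr1.
Qed.

Lemma lcurve_le t : modc (lcurve t) <= 1 + 2 * rho.
Proof.
have [h|h] := leP (modc (lcurve t)) 1; first by move: rho0; lra.
have : modc (lcurve t) <= modc (lcurve t) ^+ n by rewrite -[leLHS]expr1 ler_weXn2l// ltW.
rewrite modc_lcurve_expn.
have : rho * modc (q t) <= rho * 2 by rewrite ler_wpM2l// ltW.
lra.
Qed.

Lemma lcurve_ge t (c : R) : 0 <= c -> 2 * c ^+ n <= rho -> c <= modc (lcurve t).
Proof.
move=> c0 h; rewrite -(@ler_pXn2r _ n)// ?nnegrE ?modc_ge0// modc_lcurve_expn.
have : rho * (1 / 2) <= rho * modc (q t) by rewrite ler_wpM2l// ltW.
lra.
Qed.

Lemma lcurve'_le t : modc (lcurve' t) <= (1 + 2 * rho) * (6 * pi).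
Proof. by rewrite modcM ler_pM ?modc_ge0 ?lcurve_le ?lcurve_dlog_le. Qed.

Lemma winding_origin : integral01 (fun t => (lcurve t)^-1 * lcurve' t) = two_pi_i R.
Proof.
have -> : (fun t => (lcurve t)^-1 * lcurve' t) = lcurve_dlog.
  by apply/funext => t; rewrite mulrA mulVf ?lcurve_neq0// mul1r.
have d : cderiv (fun t => lcurve_log t +i* lcurve_arg t) lcurve_dlog by move=> t; split.
rewrite (integral01_exact d cdlog) /lcurve_log /lcurve_arg.
have -> : q 1 = q 0.
  by have := q_shift 0 n; rewrite add0r divff ?gt_eqF.
by apply/eqP; rewrite eq_complex/=; apply/andP; split; apply/eqP; ring.
Qed.

Let S := 2 * (rho + r ^+ 2 / rho).

Let expn_lip (a b : R[i]) (H : R) : modc a <= H -> modc b <= H ->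
  modc (a ^+ n - b ^+ n) <= modc (a - b) * (n%:R * H ^+ n.-1).
Proof.
move=> aH bH; rewrite subrXX modcM ler_wpM2l ?modc_ge0//.
apply: le_trans (ler_modc_sum _ _ _) _.
rewrite -[n in n%:R]card_ord mulr_natl -sumr_const; apply: ler_sum => i _.
have H0 : 0 <= H by apply: le_trans aH; exact: modc_ge0.
have -> : H ^+ n.-1 = H ^+ (n.-1 - i) * H ^+ i.
  by rewrite -exprD subnK// -ltnS prednK.
by rewrite modcM !modcX ler_pM ?exprn_ge0 ?modc_ge0// lerXn2r ?nnegrE ?modc_ge0.
Qed.

Let focal0 : focal_sum m r 0 < S.
Proof.
rewrite /focal_sum !sub0r !modcN !modcR !ger0_norm; try by move: r0 rm; lra.
have : 0 < r ^+ 2 / rho by rewrite divr_gt0// exprn_gt0.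
by rewrite /S; move: m0 rho_ge; lra.
Qed.

Lemma focal_lcurve t : focal_sum m r (lcurve t ^+ n) = S.
Proof.
rewrite lcurve_expn focal_sum_jouk ?mulf_neq0 ?expi_neq0 ?realC_eq0 ?gt_eqF//.
by rewrite modcM modc_expi mulr1 modcR_ge0// ltW.
Qed.

Let scaled_expn x z : (x%:C * z) ^+ n = (x ^+ n)%:C * z ^+ n.
Proof. by rewrite exprMn realCX. Qed.

Let unitX x : 0 <= x <= 1 -> 0 <= x ^+ n <= 1.
Proof. by move=> /andP[x0 x1]; rewrite exprn_ge0//= exprn_ile1. Qed.

Let focal_conv x z (M : R) : 0 <= x <= 1 -> focal_sum m r z <= M ->
  focal_sum m r 0 <= M -> focal_sum m r (x%:C * z) <= M.
Proof.
move=> x01 zM oM; apply: le_trans (focal_sum_scale _ _ _ x01) _.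
move: x01 => /andP[x0 x1].
have : x * focal_sum m r z <= x * M by rewrite ler_wpM2l.
have : (1 - x) * focal_sum m r 0 <= (1 - x) * M by rewrite ler_wpM2l// subr_ge0.
lra.
Qed.

(** The interior of an ellipse is convex and contains the origin, so its
    preimage under z^n is star-shaped. *)
Lemma winding_in z : focal_sum m r (z ^+ n) < S ->
  integral01 (fun t => (lcurve t - z)^-1 * lcurve' t) = two_pi_i R.
Proof.
move=> zS; rewrite -winding_origin.
pose M := Num.max (focal_sum m r (z ^+ n)) (focal_sum m r 0).
pose H := 1 + 2 * rho + modc z.
have H1 : 1 <= H by have := modc_ge0 z; rewrite /H; move: rho0; lra.
have MS : M < S by rewrite gt_max zS focal0.
have K0 : 0 < n%:R * H ^+ n.-1 by rewrite mulr_gt0// exprn_gt0// (lt_le_trans _ H1).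
apply: (winding_star dlcurve clcurve' lcurve_closed lcurve'_le
  (delta := (S - M) / 2 / (n%:R * H ^+ n.-1))).
  by rewrite divr_gt0// divr_gt0// subr_gt0.
move=> t x x01; rewrite ler_pdivrMr//.
have xz : modc (x%:C * z) <= H.
  move: x01 => /andP[x0 x1]; rewrite modcM modcR_ge0//.
  have : x * modc z <= 1 * modc z by rewrite ler_wpM2r ?modc_ge0.
  by rewrite /H; move: rho0; lra.
have gH : modc (lcurve t) <= H.
  by apply: le_trans (lcurve_le t) _; rewrite /H lerDl modc_ge0.
apply: le_trans (expn_lip gH xz).
have := focal_sum_lip m r (lcurve t ^+ n) ((x%:C * z) ^+ n).
rewrite focal_lcurve scaled_expn.
have : focal_sum m r ((x ^+ n)%:C * z ^+ n) <= M.
  by apply: focal_conv; rewrite ?unitX// le_max lexx ?orbT.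
lra.
Qed.

(** The exterior of the ellipse, dually, is invariant under dilations. *)
Lemma winding_out z : S < focal_sum m r (z ^+ n) ->
  integral01 (fun t => (lcurve t - z)^-1 * lcurve' t) = 0.
Proof.
move=> zS; pose H := 1 + 2 * rho + modc z.
have H1 : 1 <= H by have := modc_ge0 z; rewrite /H; move: rho0; lra.
have K0 : 0 < n%:R * H ^+ n.-1 by rewrite mulr_gt0// exprn_gt0// (lt_le_trans _ H1).
apply: (winding_costar dlcurve clcurve' lcurve_closed lcurve'_le
  (delta := (focal_sum m r (z ^+ n) - S) / 2 / (n%:R * H ^+ n.-1)) _ lcurve_le).
  by rewrite divr_gt0// divr_gt0// subr_gt0.
move=> t x x01; rewrite ler_pdivrMr//.
have gH : modc (x%:C * lcurve t) <= H.
  move: x01 => /andP[x0 x1]; rewrite modcM modcR_ge0//.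
  have : x * modc (lcurve t) <= 1 * modc (lcurve t) by rewrite ler_wpM2r ?modc_ge0.
  by have := lcurve_le t; have := modc_ge0 z; rewrite /H; lra.
have zH : modc z <= H by rewrite /H; move: rho0; lra.
rewrite modc_distC; apply: le_trans (expn_lip zH gH).
have := focal_sum_lip m r (z ^+ n) ((x%:C * lcurve t) ^+ n).
rewrite scaled_expn.
have : focal_sum m r ((x ^+ n)%:C * lcurve t ^+ n) <= S.
  by apply: focal_conv; rewrite ?unitX// ?focal_lcurve// ltW.
lra.
Qed.

(** Raising to the power n identifies the points of the level curve with the
    ellipse, up to a root of unity; and the roots of unity amount to shifts of
    the parameter by multiples of 1/n. *)
Lemma lcurve_image z : modc (jouk_inv m r (z ^+ n)) = rho ->
  ~ preim_segment m r n z -> exists2 t, 0 <= t <= 1 & lcurve t = z.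
Proof.
move=> zrho Ez; have [_ e] := jouk_invP r0 Ez.
have [th /andP[th0 th1] uE] := polar (jouk_inv m r (z ^+ n)).
have pi0 := pi_gt0 R.
pose t0 := th / (2 * pi * n%:R).
have e0 : z ^+ n = lcurve t0 ^+ n.
  rewrite lcurve_expn -e uE zrho; congr (jouk _ _ (_ * expi _)).
  by rewrite /t0 mulrC divfK // gt_eqF // !mulr_gt0.
have [l lE] := eq_expr_omega n0 e0.
exists (t0 + l%:R / n%:R); last by rewrite lcurve_shift.
have t00 : 0 <= t0 by rewrite divr_ge0 ?mulr_ge0 ?(ltW pi0).
rewrite (addr_ge0 t00) ?divr_ge0//=.
have : t0 <= 1 / n%:R.
  rewrite /t0 ler_pdivrMr ?mulr_gt0//.
  by rewrite [1 / _ * _](_ : _ = 2 * pi) ?(ltW th1)//; field; rewrite gt_eqF.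
have : (l.+1)%:R / n%:R <= 1 :> R by rewrite ler_pdivrMr// mul1r ler_nat.
by rewrite -natr1 mulrDl; lra.
Qed.

Lemma curve_deriv_lcurve t : curve_deriv lcurve t = lcurve' t.
Proof.
rewrite /curve_deriv !derive1E; have [[_ ->] [_ ->]] := dlcurve t.
by case: (lcurve' t).
Qed.

Lemma closed_curve_lcurve : closed_curve lcurve.
Proof.
split; last exact: lcurve_closed.
  split; first by move=> t; have [[]] := dlcurve t.
  rewrite (_ : derive1 _ = fun t => complex.Re (lcurve' t)); first exact: clcurve'.1.
  by apply/funext => t; rewrite derive1E; have [[_ ->]] := dlcurve t.
split; first by move=> t; have [_ []] := dlcurve t.
rewrite (_ : derive1 _ = fun t => complex.Im (lcurve' t)); first exact: clcurve'.2.
by apply/funext => t; rewrite derive1E; have [_ [_ ->]] := dlcurve t.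
Qed.

End LevelCurve.

(** * Faber-Walsh polynomials of the preimage of a segment *)

Section FaberWalsh.
Variables (R : realType) (m r : R).
Hypotheses (r0 : 0 < r) (rm : 2 * r < m).
Variable n : nat.
Hypothesis n0 : (0 < n)%N.
Local Notation J := (jouk_inv m r).
Local Notation E := (preim_segment m r n).
Variables (L : lemniscatic R n) (Phi : R[i] -> R[i]) (alpha : nat -> R[i]).
Hypothesis muL : mu L = r `^ n%:R^-1.
Hypothesis absU_Phi : forall z, ~ E z -> absU L (Phi z) = modc (J (z ^+ n)) `^ n%:R^-1.
Hypothesis upoly_Phi : forall k z, ~ E z -> upoly alpha (n * k) (Phi z) = J (z ^+ n) ^+ k.
Implicit Types (z : R[i]).

Let nR0 : (0 : R) < n%:R. Proof. by rewrite ltr0n. Qed.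

(** The value of lambda for which Gamma_lambda is the curve |J (z^n)| = rho. *)
Definition level_of (rho : R) : R := expR ((ln rho - ln r) / n%:R).

Lemma level_of_gt1 rho : r < rho -> 1 < level_of rho.
Proof.
move=> h; rewrite expR_gt1 divr_gt0// subr_gt0 ltr_ln// posrE//.
exact: lt_trans h.
Qed.

Lemma green_level z : ~ E z -> green L Phi z = ln (level_of (modc (J (z ^+ n)))).
Proof.
move=> Ez; rewrite /green absU_Phi// muL !ln_powR expRK.
by rewrite -mulrBr mulrC.
Qed.

Let ln_level rho : ln (level_of rho) = (ln rho - ln r) / n%:R.
Proof. exact: expRK. Qed.

Let level_lt (a b : R) : 0 < a -> 0 < b ->
  (ln (level_of a) < ln (level_of b)) = (a < b).
Proof.
move=> a0 b0; rewrite !ln_level ltr_pM2r ?invr_gt0//.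
by rewrite ltrD2r ltr_ln.
Qed.

Let modJ z : ~ E z -> r < modc (J (z ^+ n)).
Proof. by move=> /(jouk_invP r0)[]. Qed.

Let focalJ z : ~ E z -> focal_sum m r (z ^+ n) =
  2 * (modc (J (z ^+ n)) + r ^+ 2 / modc (J (z ^+ n))).
Proof.
move=> Ez; have [h e] := jouk_invP r0 Ez.
by rewrite -{1}e focal_sum_jouk// (neq0_gtr r0).
Qed.

Lemma lcurve_NE rho t : 4 * m <= rho -> ~ E (lcurve m r n rho t) /\
  J (lcurve m r n rho t ^+ n) = rho%:C * expi (2 * pi * n%:R * t).
Proof.
move=> h; rewrite /preim_segment/= lcurve_expn//.
have hr : r < modc (rho%:C * expi (2 * pi * n%:R * t)).
  by rewrite modcM modc_expi mulr1 modcR_ge0; move: r0 rm h; lra.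
by split; [exact: jouk_Nseg|exact: joukK].
Qed.

Let two_pi_i0 : two_pi_i R != 0.
Proof.
have pi0 := pi_gt0 R.
by rewrite -modc_eq0 modcE/= expr0n add0r sqrtr_sqr normr_eq0 gt_eqF// mulr_gt0.
Qed.

Let cycle_lcurve rho (f : R[i] -> R[i]) : 4 * m <= rho ->
  cycle_integral (fun _ : 'I_1 => lcurve m r n rho) f =
  integral01 (fun t => f (lcurve m r n rho t) * lcurve' m r n rho t).
Proof.
move=> h; rewrite /cycle_integral big_ord1; congr integral01.
by apply/funext => t; rewrite curve_deriv_lcurve.
Qed.

Lemma positively_oriented_lcurve rho : 4 * m <= rho ->
  positively_oriented E L Phi (level_of rho) (fun _ : 'I_1 => lcurve m r n rho).
Proof.
move=> h; have rrho : r < rho by move: r0 rm h; lra.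
have rho0 : 0 < rho by exact: lt_trans rrho.
split.
- by move=> _; exact: closed_curve_lcurve.
- apply/seteqP; split => [_ [_ _ [t _ <-]]|z [Ez gz]].
    have [Eg Jg] := lcurve_NE t h; split=> //.
    by rewrite green_level// Jg modcM modc_expi mulr1 modcR_ge0// ltW.
  have zrho : modc (J (z ^+ n)) = rho.
    have m0 : 0 < modc (J (z ^+ n)) by exact: lt_trans (modJ Ez).
    move: gz; rewrite green_level// => gz.
    by have [lt|lt|//] := ltgtP (modc (J (z ^+ n))) rho;
      move: lt; rewrite -level_lt// gz ltxx.
  have [t t01 tz] := lcurve_image r0 rm n0 h zrho Ez.
  by exists ord0 => //; exists t; rewrite //= in_itv.
- move=> z zin; rewrite /winding cycle_lcurve// winding_in ?mulVf//.
  have [Ez|Ez] := pselect (E z).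
    rewrite focal_sum_segment// (_ : 4 * r = 2 * (r + r ^+ 2 / r)); last first.
      by field; rewrite gt_eqF.
    by rewrite ltr_pM2l// focal_axis_lt.
  case: zin => // gz; rewrite focalJ// ltr_pM2l// focal_axis_lt ?(ltW (modJ _))//.
  by rewrite -level_lt ?(lt_trans r0 (modJ Ez))// -green_level.
- move=> z [Ez gz]; rewrite /winding cycle_lcurve// winding_out ?mulr0//.
  rewrite focalJ// ltr_pM2l// focal_axis_lt ?(ltW rrho)// ?modJ//.
  by rewrite -level_lt ?(lt_trans r0 (modJ Ez))// -green_level.
Qed.

(** The case k = 0 is separate because chebp 0 is the constant 2. *)
Definition cheb_lemn k : {poly R[i]} := if k is 0%N then 1 else cheb_preim m r n k.

Lemma cheb_lemn_is_chebyshev k : is_chebyshev E (n * k) (cheb_lemn k).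
Proof.
by case: k => [|k]; [exact: one_is_chebyshev|exact: cheb_preim_is_chebyshev].
Qed.

(** On the level curve J^k differs from the Chebyshev polynomial by the k-th
    power of r^2 / J, which is small on distant curves. *)
Lemma faber_walsh_near (b : R[i] -> R[i]) k z rho :
  is_faber_walsh E L Phi alpha (n * k) b -> level_int E L Phi (level_of rho) z ->
  4 * m <= rho -> r ^+ 2 <= rho -> 2 * (2 * modc z) ^+ n <= rho ->
  modc (b z - (cheb_lemn k).[z]) * rho <= 12 * r ^+ 2.
Proof.
move=> hb zin h1 h2 h3.
have rrho : r < rho by move: r0 rm h1; lra.
have rho0 : 0 < rho by exact: lt_trans rrho.
pose g := lcurve m r n rho; pose g' := lcurve' m r n rho.
pose u t : R[i] := rho%:C * expi (2 * pi * n%:R * t).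
have u0 t : u t != 0 by rewrite mulf_neq0 ?expi_neq0// realC_eq0 gt_eqF.
have g2 t : 2 * modc z <= modc (g t) by apply: lcurve_ge => //; rewrite mulr_ge0// modc_ge0.
have gpos t : 0 < modc (g t) by rewrite modc_gt0 lcurve_neq0.
have gz2 t : modc (g t) / 2 <= modc (g t - z).
  by have := lerB_modc (g t) z; have := g2 t; lra.
have gz t : g t - z != 0.
  by rewrite -modc_gt0; apply: lt_le_trans (gz2 t); rewrite divr_gt0.
pose err t : R[i] := if k is 0%N then 0 else ((r ^+ 2)%:C / u t) ^+ k.
have ue t : u t ^+ k = (cheb_lemn k).[g t] - err t.
  rewrite /err /cheb_lemn; case: (k) => [|k']; first by rewrite expr0 hornerC subr0.
  by rewrite cheb_preimE lcurve_expn// -/(u t) chebp_jouk// addrK.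
have dg : cderiv g g' by exact: dlcurve.
have cg' : ccont g' by exact: clcurve'.
have cg : ccont g by exact: cderiv_cont dg.
have cu : ccont u.
  apply: ccontM; first exact: ccont_cst.
  exact: cderiv_cont (cderiv_expi _).
have cgz : ccont (fun t => (g t - z)^-1).
  by apply: ccontV => //; apply: ccontD => //; exact: ccont_cst.
have cerr : ccont err.
  rewrite /err; case: (k) => [|k']; first exact: ccont_cst.
  by apply: ccontX; apply: ccontM; [exact: ccont_cst|exact: ccontV].
have c1 : ccont (fun t => (cheb_lemn k).[g t] / (g t - z) * g' t).
  by apply: ccontM => //; apply: ccontM => //; exact: (ccont_poly dg).
have c2 : ccont (fun t => err t / (g t - z) * g' t) by apply: ccontM => //; exact: ccontM.
have bE : b z = (cheb_lemn k).[z] -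
    (two_pi_i R)^-1 * integral01 (fun t => err t / (g t - z) * g' t).
  rewrite (hb _ _ _ (level_of_gt1 rrho) (positively_oriented_lcurve h1) _ zin).
  rewrite cycle_lcurve//.
  have -> : (fun t => upoly alpha (n * k) (Phi (lcurve m r n rho t)) /
        (lcurve m r n rho t - z) * lcurve' m r n rho t) =
      (fun t => (cheb_lemn k).[g t] / (g t - z) * g' t +
                -1 * (err t / (g t - z) * g' t)).
    apply/funext => t; have [Eg Jg] := lcurve_NE t h1.
    by rewrite upoly_Phi// Jg -/(u t) ue -/(g t) -/(g' t); ring.
  have c3 : ccont (fun t => -1 * (err t / (g t - z) * g' t)).
    by apply: ccontM => //; exact: ccont_cst.
  rewrite integral01D// integral01Z// (cauchy_poly dg cg' (lcurve_closed _ _ n0 _))//.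
  have [_ _ win _] := positively_oriented_lcurve h1.
  have := win z zin; rewrite /winding cycle_lcurve// => w1.
  rewrite mulrDr mulrCA w1; ring.
have pi0 := pi_gt0 R.
have rr : 0 <= r ^+ 2 / rho <= 1.
  by rewrite divr_ge0 ?sqr_ge0 ?(ltW rho0)//= ler_pdivrMr// mul1r.
have errle t : modc (err t) <= r ^+ 2 / rho.
  rewrite /err; case: (k) => [|k']; first by rewrite modc0; case/andP: rr.
  have -> : modc (((r ^+ 2)%:C / u t) ^+ k'.+1) = (r ^+ 2 / rho) ^+ k'.+1.
    rewrite modcX modc_div modcM modc_expi mulr1 modcR_ge0 ?sqr_ge0//.
    by rewrite modcR_ge0// ltW.
  by rewrite exprS ler_piMr ?exprn_ile1//; case/andP: rr.
have fle t : modc (err t / (g t - z) * g' t) <= r ^+ 2 / rho * (12 * pi).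
  rewrite -mulrA modcM ler_pM ?modc_ge0//.
  rewrite modcM modcV /g' /lcurve' modcM -/(g t) mulrA.
  have h4 : (modc (g t - z))^-1 * modc (g t) <= 2.
    rewrite mulrC ler_pdivrMr ?modc_gt0//; have := gz2 t; lra.
  rewrite (_ : 12 * pi = 2 * (6 * pi)); last by ring.
  by rewrite ler_pM ?modc_ge0 ?lcurve_dlog_le// mulr_ge0 ?invr_ge0 ?modc_ge0.
have := integral01_le c2 fle; set I := integral01 _ => hI.
rewrite bE addrAC subrr add0r modcN modcM modcV.
have -> : modc (two_pi_i R) = 2 * pi.
  by rewrite modcE/= expr0n add0r sqrtr_sqr ger0_norm// mulr_ge0// ltW.
rewrite -ler_pdivlMr// mulrC ler_pdivrMr ?mulr_gt0//.
apply: le_trans hI _; rewrite le_eqVlt; apply/orP; left; apply/eqP.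
by ring.
Qed.

(** The Faber-Walsh polynomial does not depend on the level curve, so the
    estimate may be used on arbitrarily distant ones. *)
Lemma faber_walsh_chebyshev (b : R[i] -> R[i]) k :
  is_faber_walsh E L Phi alpha (n * k) b -> forall z, b z = (cheb_lemn k).[z].
Proof.
move=> hb z; apply/eqP; rewrite -subr_eq0 -modc_eq0; apply/eqP.
set d := modc _; apply/eqP; rewrite eq_le modc_ge0 andbT leNgt; apply/negP => d0.
have m0 : 0 < m by move: r0 rm; lra.
pose c := 2 * (2 * modc z) ^+ n.
have c0 : 0 <= c by rewrite mulr_ge0// exprn_ge0// mulr_ge0// modc_ge0.
pose j := modc (J (z ^+ n)); have j0 : 0 <= j by exact: modc_ge0.
have r20 : 0 <= r ^+ 2 by exact: sqr_ge0.
have e0 : 0 <= 12 * r ^+ 2 / d by rewrite divr_ge0 ?mulr_ge0// ltW.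
(* The first three terms are those of the estimate, the fourth one encloses z,
   and the last one contradicts 0 < d. *)
pose rho := 4 * m + r ^+ 2 + c + j + 12 * r ^+ 2 / d.
have h1 : 4 * m <= rho by rewrite /rho; lra.
have h2 : r ^+ 2 <= rho by rewrite /rho; lra.
have h3 : c <= rho by rewrite /rho; lra.
have jr : j < rho by rewrite /rho; lra.
have rho0 : 0 < rho by lra.
have zin : level_int E L Phi (level_of rho) z.
  have [Ez|Ez] := pselect (E z); first by left.
  right; rewrite green_level// level_lt//.
  exact: lt_trans (modJ Ez).
have := faber_walsh_near hb zin h1 h2 h3; rewrite -/d leNgt => /negP; apply.
rewrite -ltr_pdivrMl// /rho; lra.
Qed.

End FaberWalsh.

(** * The radial slits *)

Section CountModulo.

Lemma count_mod_iota (n l k : nat) : (l < n)%N -> exists q s : nat,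
  [/\ (k = q * n + s)%N, (s < n)%N &
      count (fun j => j %% n == l)%N (iota 0 k) = (q + (l < s))%N].
Proof.
move=> ln; elim: k => [|k [q [s [kE sn ih]]]].
  by exists 0%N, 0%N; split=> //; exact: leq_trans ln.
rewrite -addn1 iotaD count_cat ih/= add0n addn0.
have -> : (k %% n = s)%N by rewrite kE modnMDl modn_small.
have [sn1|sn1] := ltnP s.+1 n.
  exists q, s.+1; split=> //; first by lia.
  by case: eqP => /=; lia.
exists q.+1, 0%N; split; first by nia.
  exact: leq_trans ln.
by case: eqP => /=; lia.
Qed.

End CountModulo.

Section RadialSlits.
Variables (R : realType) (n : nat) (C D : R).
Hypotheses (n2 : (2 <= n)%N) (C0 : 0 < C) (CD : C < D).

Let n0 : (0 < n)%N. Proof. exact: leq_trans n2. Qed.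
Let nR0 : (0 : R) < n%:R. Proof. by rewrite ltr0n. Qed.
Let D0 : 0 < D. Proof. exact: lt_trans CD. Qed.

Let sC : R := C `^ (n%:R / 2).
Let sD : R := D `^ (n%:R / 2).

Let sC0 : 0 < sC. Proof. exact: powR_gt0. Qed.

Let sCD : sC < sD.
Proof. by rewrite gt0_ltr_powR ?divr_gt0// nnegrE ltW. Qed.

Let powR_half (x : R) : 0 < x -> (x `^ (n%:R / 2)) ^+ 2 = x ^+ n.
Proof.
move=> x0; rewrite -powR_mulrn ?powR_ge0// -powRrM divfK//.
by rewrite powR_mulrn// ltW.
Qed.

Definition slit_mid : R := (C ^+ n + D ^+ n) / 2.
Definition slit_cap : R := (D ^+ n - C ^+ n) / 4.
(** The zeros of the Joukowski map of the segment [C^n, D^n] are - slit_p0 and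
    - slit_p1; the foci are the n-th roots of slit_p0. *)
Definition slit_p0 : R := ((sD + sC) / 2) ^+ 2.
Definition slit_p1 : R := ((sD - sC) / 2) ^+ 2.
Definition slit_focus : R := ((sD + sC) / 2) `^ (2 / n%:R).

Let CnE : C ^+ n = sC ^+ 2. Proof. by rewrite powR_half. Qed.
Let DnE : D ^+ n = sD ^+ 2. Proof. by rewrite powR_half. Qed.

Lemma slit_p1_gt0 : 0 < slit_p1.
Proof. by rewrite exprn_gt0// divr_gt0// subr_gt0. Qed.

Lemma slit_p1_lt : slit_p1 < slit_cap.
Proof.
rewrite /slit_cap CnE DnE -subr_gt0 /slit_p1.
have -> : (sD ^+ 2 - sC ^+ 2) / 4 - ((sD - sC) / 2) ^+ 2 = (sD - sC) * sC / 2 by field.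
by rewrite divr_gt0// mulr_gt0// subr_gt0.
Qed.

Lemma slit_pM : slit_p0 * slit_p1 = slit_cap ^+ 2.
Proof. by rewrite /slit_p0 /slit_p1 /slit_cap CnE DnE; field. Qed.

Lemma slit_pD : slit_p0 + slit_p1 = slit_mid.
Proof. by rewrite /slit_p0 /slit_p1 /slit_mid CnE DnE; field. Qed.

Lemma slit_focus_gt0 : 0 < slit_focus.
Proof. by rewrite powR_gt0// divr_gt0// addr_gt0// (lt_trans sC0). Qed.

Lemma slit_focusX : slit_focus ^+ n = slit_p0.
Proof.
have s0 : 0 <= (sD + sC) / 2 by rewrite divr_ge0// addr_ge0 ?powR_ge0.
by rewrite -powR_mulrn ?powR_ge0// -powRrM divfK ?gt_eqF// powR_mulrn.
Qed.

Lemma slit_cap_gt0 : 0 < slit_cap.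
Proof. exact: lt_trans slit_p1_gt0 slit_p1_lt. Qed.

Lemma slit_mid_gt : 2 * slit_cap < slit_mid.
Proof.
have : 0 < C ^+ n by rewrite exprn_gt0.
by rewrite /slit_cap /slit_mid; lra.
Qed.

Local Notation E := (preim_segment slit_mid slit_cap n).

Lemma radial_setE : radial_set n C D = E.
Proof.
have s1 : slit_mid - 2 * slit_cap = C ^+ n by rewrite /slit_mid /slit_cap; field.
have s2 : slit_mid + 2 * slit_cap = D ^+ n by rewrite /slit_mid /slit_cap; field.
apply/seteqP; split=> z.
  move=> [j [x [_ /andP[x1 x2] ->]]]; exists (x ^+ n).
    have x0 : 0 <= x by apply: le_trans x1; exact: ltW.
    by rewrite s1 s2 !ler_pXn2r ?nnegrE ?(ltW C0) ?(ltW D0)// x1.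
  by rewrite -omegaX exprMn exprAC omega_expn// expr1n mul1r realCX.
move=> [x /andP[x1 x2] zx]; rewrite s1 in x1; rewrite s2 in x2.
have x0 : 0 <= x by apply: le_trans x1; rewrite exprn_ge0// ltW.
have zn : modc z ^+ n = x by rewrite -modcX zx modcR_ge0.
have [l lE] : exists l : 'I_n, z = (modc z)%:C * omega R n ^+ l.
  by apply: eq_expr_omega => //; rewrite zx -realCX zn.
(* The slits are numbered from 1 to n, so the trivial rotation is number n. *)
exists (if l == 0 :> nat then n else l), (modc z); split.
- by case: ifPn => [_|l0]; rewrite ?leqnn ?n0// lt0n l0 ltnW.
- by apply/andP; split; rewrite -(@ler_pXn2r _ n) ?nnegrE ?modc_ge0 ?(ltW C0) ?(ltW D0)// zn.
- rewrite -omegaX mulrC {1}lE; congr (_ * _).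
  by case: ifPn => // /eqP ->; rewrite omega_expn// expr0.
Qed.

Lemma radial_foci_omega (j : nat) :
  radial_foci n C D j = slit_focus%:C * omega R n ^+ j.-1.
Proof. by rewrite /radial_foci -omegaX mulrC. Qed.

Local Notation L0 := (radial_lemn slit_p1_gt0 slit_p1_lt n2 slit_focus_gt0).
Local Notation Phi0 := (lemn_map slit_mid slit_cap slit_p1 n).

Lemma radial_lemniscatic_map : lemniscatic_map E L0 Phi0.
Proof.
exact: (lemniscatic_map_radial _ _ slit_pM slit_pD _ _ slit_focusX).
Qed.

Lemma upoly_radial k (w : R[i]) :
  upoly (radial_foci n C D) (n * k) w = (w ^+ n - slit_p0%:C) ^+ k.
Proof.
rewrite /upoly big_add1/= big_mkord.
under eq_bigr do rewrite radial_foci_omega.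
elim: k => [|k ih]; first by rewrite muln0 big_ord0 expr0.
rewrite mulnS addnC big_split_ord/= ih exprSr; congr (_ * _).
rewrite -slit_focusX realCX -(prod_sub_omega _ _ n0); apply: eq_bigr => i _.
by rewrite exprD exprM omega_expn// expr1n mul1r.
Qed.

Section Transfer.
Variables (L : lemniscatic R n) (Phi : R[i] -> R[i]) (s : 'S_n).
Hypothesis sP : forall j, foci L0 j = foci L (s j) /\ expo L0 j = expo L (s j).

(** Each focus occurs exactly once among any n consecutive terms. *)
Lemma radial_admissible : admissible L (radial_foci n C D).
Proof.
split=> [j _|].
  have jn : (j.-1 %% n < n)%N by rewrite ltn_mod.
  exists (s (Ordinal jn)); rewrite -(sP _).1 /= radial_foci_omega.
  by rewrite -(prim_expr_mod (omega_prim R n0)).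
exists 1; split=> // k l _.
pose l0 := (s^-1)%g l; have lE : l = s l0 by rewrite permKV.
rewrite lE -(sP _).1 -(sP _).2 /=.
have -> : count (fun j => radial_foci n C D j == slit_focus%:C * omega R n ^+ l0) (iota 1 k)
  = count (fun j => j %% n == l0)%N (iota 0 k).
  rewrite (iotaDl 1 0) count_map; apply: eq_count => j /=.
  have f0 : slit_focus%:C != 0 :> R[i] by rewrite realC_eq0 gt_eqF// slit_focus_gt0.
  rewrite radial_foci_omega/= (inj_eq (mulfI f0)).
  by rewrite (eq_prim_root_expr (omega_prim R n0)) (modn_small (ltn_ord l0)).
have [q [t [kE tn ->]]] := count_mod_iota k (ltn_ord l0).
have -> : (q + (l0 < t))%:R - k%:R / n%:R = (l0 < t)%N%:R - t%:R / n%:R :> R.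
  by rewrite kE !natrD natrM; field; rewrite gt_eqF.
have t1 : 0 <= (t%:R / n%:R : R) <= 1.
  by rewrite divr_ge0//= ler_pdivrMr// mul1r ler_nat ltnW.
by rewrite ler_norml; case: (l0 < t)%N; move: t1; rewrite ?mulr1n ?mulr0n; lra.
Qed.

Lemma absU_perm w : absU L w = absU L0 w.
Proof.
rewrite /absU (reindex_inj (@perm_inj _ s)); apply: eq_bigr => j _.
by have [-> ->] := sP j.
Qed.

End Transfer.

End RadialSlits.

Theorem theorem4p2 (R : realType) (n : nat) (C D : R)
    (hn : (2 <= n)%N) (hC : 0 < C) (hCD : C < D)
    (L : lemniscatic R n) (Phi : R[i] -> R[i])
    (hPhi : is_the_lemniscatic_map (radial_set n C D) L Phi) :
  admissible L (radial_foci n C D) /\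
  forall b : nat -> R[i] -> R[i],
    (forall k, is_faber_walsh (radial_set n C D) L Phi (radial_foci n C D)
                 k (b k)) ->
    forall k : nat, exists T : {poly R[i]},
      is_chebyshev (radial_set n C D) (n * k) T /\
      forall z : R[i], b (n * k)%N z = T.[z].
Proof.
have n0 : (0 < n)%N by exact: leq_trans hn.
case: hPhi => _; rewrite radial_setE// => uniq.
have [[s sP] muE PhiE] := uniq _ _ (radial_lemniscatic_map hn hC hCD).
split=> [|b hb k]; first exact: radial_admissible sP.
have r0 := slit_cap_gt0 hn hC hCD; have rm := slit_mid_gt n D hC.
have Phi0X z : ~ preim_segment (slit_mid n C D) (slit_cap n C D) n z ->
    Phi z ^+ n - (slit_p0 n C D)%:C = jouk_inv (slit_mid n C D) (slit_cap n C D) (z ^+ n).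
  move=> Ez; rewrite -PhiE//.
  rewrite (lemn_map_expn (slit_p1_gt0 hn hC hCD) (slit_p1_lt hn hC hCD)
    (slit_pM n hC hCD) (slit_pD n hC hCD) hn Ez).
  exact: addrK.
exists (cheb_lemn (slit_mid n C D) (slit_cap n C D) n k).
split; first exact: cheb_lemn_is_chebyshev.
apply: (faber_walsh_chebyshev r0 rm n0 _ _ _ (hb _)); first by rewrite -muE.
  by move=> z Ez; rewrite (absU_perm sP) (absU_radial _ _ _ _ (slit_focusX C D hn)) Phi0X.
by move=> k' z Ez; rewrite upoly_radial// Phi0X.
Qed.
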